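(* Let $H$ be a forest whose connected components are the trees $T_1,\dots,T_k$, and let $b$ be a positive integer. (1) If $H$ is a tree ($k=1$), then there exists a tree $T$ such that Maker, moving first, wins the $(1:b)$ Maker-Breaker vertex $H$-game played on $T$. (2) For $1\le i\le k$ let $T^{(i)}_{\min}$ be a tree with the minimum number of vertices such that Maker, moving first, wins the $(1:b)$ Maker-Breaker vertex $T_i$-game played on $T^{(i)}_{\min}$, and let $T_{\max}$ be one of the trees $T^{(i)}_{\min}$ with the maximum number of vertices. Write $v=v(T_{\max})$, $e=e(T_{\max})$. Then for $G\sim G(n,p)$: if $p=\omega(n^{-v/e})$ then w.h.p. Maker wins the $(1:b)$ Maker-Breaker vertex $H$-game on $G$, and if $p=o(n^{-v/e})$ then w.h.p. Breaker wins it (in both cases regardless of which player moves first).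
   Context: $G(n,p)$ is the binomial random graph; ''w.h.p.'' means with probability tending to $1$ as $n\to\infty$. For graphs $G,H$ and a positive integer $b$, the $(1:b)$ Maker-Breaker vertex $H$-game on $G$ is played as follows: Maker and Breaker alternately claim previously unclaimed vertices of $G$, Maker claiming one vertex per turn and Breaker claiming $b$ vertices per turn (the last player may claim fewer if not enough free vertices remain), until all vertices are claimed. Maker wins if the subgraph of $G$ induced by the set of vertices he claimed contains a (not necessarily induced) copy of $H$; otherwise Breaker wins. *)

(* Defs.v *)
From Stdlib Require Import Reals.
From mathcomp Require Import all_boot.
Set Implicit Arguments. Unset Strict Implicit. Unset Printing Implicit Defensive.

Definition simple_graph (V : finType) (e : rel V) : Prop :=
  symmetric e /\ irreflexive e.

Definition acyclic (V : finType) (e : rel V) : Prop :=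
  forall c : seq V, uniq c -> 2 < size c -> ~~ cycle e c.

Definition connected (V : finType) (e : rel V) : Prop :=
  forall x y : V, connect e x y.

Definition is_tree (V : finType) (e : rel V) : Prop :=
  0 < #|V| /\ connected e /\ acyclic e.
Definition is_forest (V : finType) (e : rel V) : Prop := acyclic e.

Definition component (V : finType) (e : rel V) (x : V) : {set V} :=
  [set y | connect e x y].

Definition nedges (m : nat) (e : rel 'I_m) : nat :=
  #|[set u : 'I_m * 'I_m | (u.1 < u.2)%N && e u.1 u.2]|.

Definition has_copy (VH : finType) (eH : rel VH) (S : {set VH})
  (VG : finType) (eG : rel VG) (M : {set VG}) : bool :=
  [exists f : {ffun VH -> VG},
    [&& [forall x in S, f x \in M],
        [forall x in S, forall y in S, (f x == f y) ==> (x == y)] &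
        [forall x in S, forall y in S, eH x y ==> eG (f x) (f y)]]].

(* mwin k M B mt : Maker (with claimed set M, Breaker's set B, Maker to move iff mt)
   can force a win; k is fuel (each move claims at least one free vertex). *)
Fixpoint mwin (VH : finType) (eH : rel VH) (S : {set VH}) (b : nat)
  (VG : finType) (eG : rel VG) (k : nat) (M B : {set VG}) (mt : bool) : bool :=
  match k with
  | 0 => has_copy eH S eG M
  | k'.+1 =>
    let F := ~: (M :|: B) in
    if F == set0 then has_copy eH S eG M
    else if mt then [exists x in F, mwin eH S b eG k' (x |: M) B false]
    else [forall T : {set VG},
            ((T \subset F) && (#|T| == minn b #|F|)) ==>
              mwin eH S b eG k' M (B :|: T) true]
  end.

Definition maker_wins (VH : finType) (eH : rel VH) (S : {set VH}) (b : nat)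
  (VG : finType) (eG : rel VG) (makerfirst : bool) : bool :=
  mwin eH S b eG #|VG|.+1 set0 set0 makerfirst.

(* A finite game without draws: Breaker wins iff Maker does not. *)
Definition breaker_wins (VH : finType) (eH : rel VH) (S : {set VH}) (b : nat)
  (VG : finType) (eG : rel VG) (makerfirst : bool) : bool :=
  ~~ maker_wins eH S b eG makerfirst.

(* an outcome is a set E of pairs (x,y) with x < y (the edge set) *)
Definition upper_pairs (n : nat) : {set 'I_n * 'I_n} :=
  [set u : 'I_n * 'I_n | (u.1 < u.2)%N].

Definition adjE (n : nat) (E : {set 'I_n * 'I_n}) : rel 'I_n :=
  fun x y => ((x, y) \in E) || ((y, x) \in E).

Definition PrGnp (n : nat) (p : R) (P : rel 'I_n -> bool) : R :=
  \big[Rplus/R0]_(E : {set 'I_n * 'I_n} | (E \subset upper_pairs n) && P (adjE E))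
     Rmult (pow p #|E|) (pow (Rminus R1 p) ('C(n, 2) - #|E|)).

Definition whp (P : forall n : nat, rel 'I_n -> bool) (p : nat -> R) : Prop :=
  Un_cv (fun n => PrGnp (p n) (P n)) R1.

(* Main.v *)
Require Import Defs.
From Stdlib Require Import Reals.
From mathcomp Require Import all_boot all_order all_algebra.
From mathcomp Require Import boolp Rstruct.
From mathcomp Require Import zify ring lra.
Set Implicit Arguments. Unset Strict Implicit. Unset Printing Implicit Defensive.

(**
Maker wins inside a copy of a host tree, so whether he wins on [G(n, p)] is
decided by the trees that appear there. Above the threshold the second moment
method yields, for every component of [H], more disjoint copies of its host tree
than Breaker can touch before Maker has built all components one by one. Below
it the first moment method shows that [G(n, p)] is a forest all of whose
components have fewer than [v] vertices; by minimality of [v] Breaker wins on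
each of them, and answering in the component where Maker has just played he
prevents the critical component of [H]. The host tree of (1) is a [K]-ary tree
with [K] so large that Maker can embed [H] greedily.
*)

(** * Forcing in the Maker-Breaker game *)

(** A host tree is known only through the fact that Maker wins on it, so his strategy must be moved
    into a copy, into a component, or past an opening of Breaker. Moves of exact size, compulsory
    even when useless, do not restrict to part of a board; hence the arguments use [forces],
    compared with [mwin] once in each direction. The exponent is v/(v-1) because a tree on a
    vertices has expected count of order n^a p^(a-1). If p n^(v/(v-1)) is large, so are these counts
    for all a from 2 to v; subtrees are then no obstruction, and smaller host trees appear too. If
    it is small, so is n p, which excludes cycles of bounded length; a longer cycle would need a
    large component. Disjointness is arranged in advance: each of constantly many slots owns some
    residue classes of vertices modulo a constant, so one copy per slot and a union bound
    suffice. *)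

(* Maker is to move and completes a set in [W] within [k] of his moves. He may
   pass or play a vertex he owns, and Breaker claims at most (rather than
   exactly) [b] vertices, possibly his own: this flexibility makes the relation
   stable under simulation between boards. *)
Fixpoint forces (V : finType) (W : pred {set V}) (b k : nat) (M B : {set V}) : Prop :=
  W M \/
  match k with
  | 0 => False
  | k'.+1 => exists2 X : {set V}, #|X| <= 1 /\ [disjoint X & B] &
      forall T : {set V}, #|T| <= b -> [disjoint T & X :|: M] ->
        forces W b k' (X :|: M) (B :|: T)
  end.

Lemma forces_now (V : finType) (W : pred {set V}) b k M B : W M -> forces W b k M B.
Proof. by case: k => [|k] h; left. Qed.

Lemma forces_leq (V : finType) (W : pred {set V}) b k k' M B :
  k <= k' -> forces W b k M B -> forces W b k' M B.
Proof.
elim: k k' M B => [|k IH] k' M B hk /=; first by case=> // h; exact: forces_now.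
case: k' hk => // k' hk [h|[X hX h]]; first exact: forces_now.
by right; exists X => // T hT hd; apply: IH => //; exact: h.
Qed.

(** Breaker may pass throughout, and Maker's final set extends to the whole board. Thus a host on
    which Maker wins contains a copy of the target. *)
Lemma forces_setT (V : finType) (W : pred {set V}) b k M B :
  (forall M M' : {set V}, M \subset M' -> W M -> W M') ->
  forces W b k M B -> W setT.
Proof.
move=> mono; elim: k M B => [|k IH] M B /=.
  by case=> // /(mono _ setT); apply; apply: subsetT.
case=> [/(mono _ setT)|[X _ /(_ set0)]]; first by apply; apply: subsetT.
by rewrite cards0 -setI_eq0 set0I eqxx => /(_ isT isT) /IH.
Qed.

(** Choosing a partner in [T] is injective on [T']. This bounds the size of transported moves, and
    later the number of disjoint copies that Breaker touches. *)
Lemma card_rel_image (U V : finType) (r : U -> V -> bool) (T : {set V}) (T' : {set U}) :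
  (forall u u' v, r u v -> r u' v -> u = u') ->
  (forall u, u \in T' -> exists2 v, v \in T & r u v) -> #|T'| <= #|T|.
Proof.
move=> rinj h.
have [/eqP->|/set0Pn [u0 hu0]] := boolP (T' == set0); first by rewrite cards0.
have [v0 _ _] := h _ hu0.
pose f u := odflt v0 [pick v in T | r u v].
have fP u : u \in T' -> f u \in T /\ r u (f u).
  move=> /h [v vT ruv]; rewrite /f; case: pickP => [w /andP[]//|/(_ v)].
  by rewrite vT ruv.
have finj : {in T' &, injective f}.
  move=> u u' /fP [_ hu] /fP [_ hu'] e; apply: rinj hu _; by rewrite e.
rewrite -(card_in_imset finj); apply: subset_leq_card.
by apply/subsetP => _ /imsetP [u /fP [hu _] ->].
Qed.

(** [r] is a partial matching of two boards. Maker plays the partners of his moves and reads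
    Breaker's replies back through [r]; whatever has no partner counts as a pass. *)
Lemma forces_sim (U V : finType) (r : U -> V -> bool)
    (WU : pred {set U}) (WV : pred {set V}) b k :
  (forall u u' v, r u v -> r u' v -> u = u') ->
  (forall u v v', r u v -> r u v' -> v = v') ->
  (forall (M : {set U}) (M' : {set V}),
     (forall u v, r u v -> u \in M -> v \in M') -> WU M -> WV M') ->
  forall (M B : {set U}) (M' B' : {set V}),
  (forall u v, r u v -> u \in M -> v \in M') ->
  (forall u v, r u v -> v \in B' -> u \in B) ->
  forces WU b k M B -> forces WV b k M' B'.
Proof.
move=> r1 r2 hW; elim: k => [|k IH] M B M' B' hM hB /=.
  by case=> // /(hW _ _ hM); left.
case=> [/(hW _ _ hM)|[X [hX1 hXB] h]]; [by left|right].
pose X' := [set v | [exists u in X, r u v]].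
exists X'.
  split.
    apply: leq_trans hX1; apply: (@card_rel_image _ _ (fun v u => r u v)).
      by move=> v v' u h1 h2; apply: r2 h1 h2.
    by move=> v; rewrite inE => /exists_inP.
  apply/pred0P => v /=; apply/negP => /andP[]; rewrite inE => /exists_inP [u uX ruv] vB.
  by move/pred0P: hXB => /(_ u) /=; rewrite uX (hB _ _ ruv vB).
move=> T' hT' hd.
pose T := [set u | [exists v in T', r u v]].
have hXM u v : r u v -> u \in X :|: M -> v \in X' :|: M'.
  move=> ruv; rewrite !inE => /orP [uX|uM]; last by rewrite (hM _ _ ruv uM) orbT.
  by apply/orP; left; apply/exists_inP; exists u.
apply: IH (h T _ _) => //.
- move=> u v ruv; rewrite !inE => /orP [vB|vT]; first by rewrite (hB _ _ ruv vB).
  by apply/orP; right; apply/exists_inP; exists v.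
- apply: leq_trans hT'; apply: (@card_rel_image _ _ r) => // u.
  by rewrite inE => /exists_inP.
- apply/pred0P => u /=; apply/negP => /andP[]; rewrite inE => /exists_inP [v vT ruv] uX.
  by move/pred0P: hd => /(_ v) /=; rewrite vT (hXM _ _ ruv uX).
Qed.

(** While Maker pursues the first goal Breaker gains at most [b * k] vertices, and the second
    strategy must cope with any such set. *)
Lemma forces_seq (V : finType) (W1 W : pred {set V}) b k k' (M B : {set V}) :
  forces W1 b k M B ->
  (forall M' B' : {set V}, M \subset M' -> #|B'| <= #|B| + b * k -> W1 M' ->
     forces W b k' M' B') ->
  forces W b (k + k') M B.
Proof.
elim: k M B => [|k IH] M B.
  by case=> // h hW; apply: hW => //; rewrite muln0 addn0.
case=> [h|[X hX h]] hW.
  by apply: (@forces_leq _ _ _ k'); [lia|apply: hW => //; lia].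
rewrite addSn; right; exists X => // T hT hd.
apply: IH (h T hT hd) _ => M' B' hM' hB'; apply: hW.
  by apply: subset_trans hM'; apply: subsetUr.
have := cardsUI B T; nia.
Qed.

(** * Comparison with the game of exact moves *)

Lemma has_copyP (VH : finType) (eH : rel VH) (S : {set VH})
    (VG : finType) (eG : rel VG) (M : {set VG}) :
  reflect (exists f : VH -> VG,
    [/\ {in S, forall x, f x \in M}, {in S &, injective f} &
        {in S &, forall x y, eH x y -> eG (f x) (f y)}])
    (has_copy eH S eG M).
Proof.
apply: (iffP existsP) => [[f /and3P[h1 h2 h3]]|[f [h1 h2 h3]]].
  exists f; split.
  - by move=> x xS; apply: (forall_inP h1).
  - move=> x y xS yS e.
    by move/forall_inP: h2 => /(_ x xS) /forall_inP /(_ y yS) /implyP; rewrite e eqxx => /(_ isT)/eqP.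
  - by move=> x y xS yS; move/forall_inP: h3 => /(_ x xS) /forall_inP /(_ y yS) /implyP.
exists (finfun f); apply/and3P; split.
- by apply/forall_inP => x xS; rewrite ffunE h1.
- apply/forall_inP => x xS; apply/forall_inP => y yS; rewrite !ffunE.
  by apply/implyP => /eqP /h2 -> //.
- apply/forall_inP => x xS; apply/forall_inP => y yS; rewrite !ffunE.
  by apply/implyP; apply: h3.
Qed.

Lemma has_copyS (VH : finType) (eH : rel VH) (S S' : {set VH})
    (VG : finType) (eG : rel VG) (M M' : {set VG}) :
  S' \subset S -> M \subset M' -> has_copy eH S eG M -> has_copy eH S' eG M'.
Proof.
move=> /subsetP hS /subsetP hM /has_copyP [f [h1 h2 h3]]; apply/has_copyP; exists f; split.
- by move=> x /hS /h1 /hM.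
- by move=> x y /hS xS /hS yS; apply: h2.
- by move=> x y /hS xS /hS yS; apply: h3.
Qed.

Lemma mwin_full (VH : finType) (eH : rel VH) S b (VG : finType) (eG : rel VG) k M B mt :
  ~: (M :|: B) = set0 -> mwin eH S b eG k M B mt = has_copy eH S eG M.
Proof. by case: k => [|k] //= ->; rewrite eqxx. Qed.

Lemma mwin_now (VH : finType) (eH : rel VH) S b (VG : finType) (eG : rel VG) k M B mt :
  has_copy eH S eG M -> mwin eH S b eG k M B mt.
Proof.
elim: k M B mt => [|k IH] M B mt h //=.
case: ifP => // /negbT /set0Pn [x xF]; case: mt.
  by apply/exists_inP; exists x => //; apply: IH; apply: has_copyS h => //; apply: subsetUr.
by apply/forall_inP => T _; apply: IH.
Qed.

Lemma extend_card (V : finType) (T F : {set V}) s :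
  T \subset F -> #|T| <= s <= #|F| ->
  exists T' : {set V}, [/\ T \subset T', T' \subset F & #|T'| = s].
Proof.
move=> TF /andP[h1 h2]; have [d hd] : exists d, d = s - #|T| by eexists.
elim: d T TF hd h1 => [|d IH] T TF hd h1; first by exists T; split => //; lia.
have : 0 < #|F :\: T|.
  by rewrite cardsD (setIidPr TF); lia.
rewrite card_gt0 => /set0Pn [x /setDP [xF xT]].
have [|||T' [h3 h4 h5]] := IH (x |: T); rewrite ?cardsU1 ?xT //=; try lia.
  by rewrite subUset sub1set xF.
by exists T'; split => //; apply: subset_trans h3; apply: subsetUr.
Qed.

Arguments forces : simpl never.

(** The relaxed position may be better for Maker than the exact one, which makes the induction go
    through. Since [forces] always has Maker to move, a pending reply [T] of Breaker is quantified
    in front of it. *)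
Lemma mwin_forces (VH : finType) (eH : rel VH) S b (VG : finType) (eG : rel VG) k
    (M B M' B' : {set VG}) mt :
  mwin eH S b eG k M B mt -> M \subset M' -> B' \subset B ->
  if mt then forces (has_copy eH S eG) b k M' B'
  else forall T : {set VG}, #|T| <= b -> [disjoint T & M'] ->
         forces (has_copy eH S eG) b k M' (B' :|: T).
Proof.
have now k0 (M0 M1 B0 : {set VG}) (mt0 : bool) : has_copy eH S eG M0 -> M0 \subset M1 ->
  if mt0 then forces (has_copy eH S eG) b k0 M1 B0
  else forall T : {set VG}, #|T| <= b -> [disjoint T & M1] ->
         forces (has_copy eH S eG) b k0 M1 (B0 :|: T).
  move=> h hM; have h' : has_copy eH S eG M1 by apply: has_copyS h.
  by case: mt0 => *; apply: forces_now.
elim: k M B M' B' mt => [|k IH] M B M' B' mt /=.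
  by move=> h hM _; apply: now h hM.
case: ifP => [_ h hM _|_]; first by apply: now h hM.
case: mt => [/exists_inP [x]|/forall_inP h hM hB T' hT' hd].
  rewrite !inE negb_or => /andP [xM xB] /IH {}IH hM hB; right; exists [set x].
    rewrite cards1 disjoints1; split => //.
    by apply: contra xB => /(subsetP hB).
  by apply: IH => //; apply: setUS.
(* A relaxed reply may be short or waste vertices; its free part is extended to a legal move of
   exact size, which is at least as good for Breaker. *)
have [||T [h1 h2 h3]] := @extend_card _ (T' :&: ~: (M :|: B)) (~: (M :|: B)) (minn b #|~: (M :|: B)|).
- exact: subsetIr.
- rewrite geq_minr andbT leq_min subset_leq_card ?subsetIr // andbT.
  by apply: leq_trans hT'; rewrite subset_leq_card ?subsetIl.
apply: (@forces_leq _ _ _ k) => //.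
have /h /IH : (T \subset ~: (M :|: B)) && (#|T| == minn b #|~: (M :|: B)|) by rewrite h2 h3 eqxx.
apply=> //; apply/subsetP => z; rewrite !inE => /orP [/(subsetP hB)->//|zT].
case: (boolP (z \in B)) => //= zB; apply: (subsetP h1); rewrite !inE zT /= (negbTE zB) orbF.
by apply/negP => /(subsetP hM) zM; move/pred0P: hd => /(_ z) /=; rewrite zT zM.
Qed.

(** A pass of Maker becomes an arbitrary free vertex, which cannot hurt him. While [k] counts
    Maker's moves, [K] only has to cover the free vertices, as every exact move uses one up because
    [0 < b]. *)
Lemma forces_mwin (VH : finType) (eH : rel VH) S b (VG : finType) (eG : rel VG) k :
  0 < b ->
  (forall (M B M' B' : {set VG}) K, forces (has_copy eH S eG) b k M B ->
     M \subset M' -> B' \subset B -> #|~: (M' :|: B')| <= K -> mwin eH S b eG K M' B' true)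
  /\
  (forall (M B M' B' : {set VG}) K,
     (forall T : {set VG}, #|T| <= b -> [disjoint T & M] ->
        forces (has_copy eH S eG) b k M (B :|: T)) ->
     M \subset M' -> B' \subset B -> #|~: (M' :|: B')| <= K -> mwin eH S b eG K M' B' false).
Proof.
move=> hb; set W := has_copy eH S eG.
pose Pt k := forall (M B M' B' : {set VG}) K, forces W b k M B ->
     M \subset M' -> B' \subset B -> #|~: (M' :|: B')| <= K -> mwin eH S b eG K M' B' true.
pose Pf k := forall (M B M' B' : {set VG}) K,
     (forall T : {set VG}, #|T| <= b -> [disjoint T & M] -> forces W b k M (B :|: T)) ->
     M \subset M' -> B' \subset B -> #|~: (M' :|: B')| <= K -> mwin eH S b eG K M' B' false.
(* A single exact reply of Breaker leads back to Maker's turn with the same [k], so only [Pt] needs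
   the induction. *)
have Ptf k0 : Pt k0 -> Pf k0.
  move=> IH M B M' B' K h hM hB hK.
  have [F0|F0] := eqVneq (~: (M' :|: B')) set0.
    rewrite mwin_full // -(mwin_full eH S b eG K true F0).
    apply: (IH M (B :|: set0)) => //; last by rewrite setU0.
    by apply: h; rewrite ?cards0 // -setI_eq0 set0I.
  have Fp : 0 < #|~: (M' :|: B')| by rewrite card_gt0.
  case: K hK => [|K] hK; first by lia.
  rewrite /= (negbTE F0); apply/forall_inP => T /andP [TF /eqP hT].
  have hd : [disjoint T & M'].
    by move: TF; rewrite setCU subsetI -!disjoints_subset => /andP[].
  apply: (IH M (B :|: T)) => //.
  - apply: h; first by rewrite hT geq_minl.
    by rewrite disjoint_sym; apply: disjointWl hM _; rewrite disjoint_sym.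
  - exact: setSU.
  - rewrite setUA setCU -setDE cardsD (setIidPr TF) hT; 
    have : 0 < minn b #|~: (M' :|: B')| by rewrite leq_min hb.
    lia.
suff H : forall k0, Pt k0 by split; [exact: H|apply: Ptf; exact: H].
elim=> [|k0 IH] M B M' B' K /=.
  by case=> // h hM _ _; apply: mwin_now; apply: has_copyS h.
case=> [h hM _ _|[X [hX hd] h] hM hB hK]; first by apply: mwin_now; apply: has_copyS h.
have {}IH := Ptf _ IH.
have hXB x : x \in X -> x \notin B'.
  move=> xX; apply/negP => /(subsetP hB) xB.
  by move/pred0P: hd => /(_ x) /=; rewrite xX xB.
have [F0|F0] := eqVneq (~: (M' :|: B')) set0.
  rewrite mwin_full // -(mwin_full eH S b eG K false F0).
  apply: IH h _ hB hK; rewrite subUset hM andbT; apply/subsetP => x xX.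
  have := in_set0 x; rewrite -F0 !inE (negbTE (hXB x xX)) orbF.
  by move/negbFE.
have Fp : 0 < #|~: (M' :|: B')| by rewrite card_gt0.
case: K hK => [|K] hK; first by lia.
rewrite /= (negbTE F0).
(* The vertex of [X] is played if it is free; if Maker passes or already owns it, any free vertex is
   played instead. *)
have [y yF hy] : exists2 y, y \in ~: (M' :|: B') & X \subset y |: M'.
  have [hXM|] := boolP (X \subset M').
    have /set0Pn [y yF] := F0; exists y => //; apply: subset_trans hXM _; exact: subsetUr.
  case/subsetPn => x xX xM; exists x; first by rewrite !inE negb_or xM hXB.
  have /card_le1_eqP hX' := hX.
  by apply/subsetP => z zX; rewrite !inE (hX' z x zX xX) eqxx.
apply/exists_inP; exists y => //; apply: IH h _ hB _.
  by rewrite subUset hy (subset_trans hM) // subsetUr.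
have -> : ~: (y |: M' :|: B') = ~: (M' :|: B') :\ y.
  by apply/setP => z; rewrite !inE !negb_or -!andbA.
by move: (cardsD1 y (~: (M' :|: B'))); rewrite yF; lia.
Qed.

(** If Breaker begins, he may claim nothing, so a win of Maker as second player also gives [forces]
    from the empty position. *)
Lemma maker_wins_forces (VH : finType) (eH : rel VH) S b (VG : finType) (eG : rel VG) mf :
  maker_wins eH S b eG mf -> forces (has_copy eH S eG) b #|VG|.+1 set0 set0.
Proof.
move/mwin_forces => /(_ set0 set0 (subxx _) (subxx _)); case: mf => // /(_ set0).
by rewrite cards0 setU0 -setI_eq0 set0I eqxx; apply.
Qed.

Lemma forces_maker_first (VH : finType) (eH : rel VH) S b (VG : finType) (eG : rel VG) k :
  0 < b -> forces (has_copy eH S eG) b k set0 set0 -> maker_wins eH S b eG true.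
Proof.
move=> hb h; have [h1 _] := @forces_mwin VH eH S b VG eG k hb.
by apply: h1 h (subxx _) (subxx _) _; apply: leq_trans (max_card _) _.
Qed.

(** Breaker's possible opening is treated as the initial set [B], which covers both orders of
    play. *)
Lemma forces_maker_wins (VH : finType) (eH : rel VH) S b (VG : finType) (eG : rel VG) k mf :
  0 < b -> (forall B : {set VG}, #|B| <= b -> forces (has_copy eH S eG) b k set0 B) ->
  maker_wins eH S b eG mf.
Proof.
move=> hb h; have [h1 h2] := @forces_mwin VH eH S b VG eG k hb.
have hc : #|~: (set0 :|: set0 : {set VG})| <= #|VG|.+1.
  by apply: leq_trans (max_card _) _.
case: mf; first by apply: h1 (h set0 _) _ _ hc => //; rewrite cards0.
by apply: h2 _ (subxx _) (subxx _) hc => T hT _; rewrite set0U; apply: h.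
Qed.

(** * Playing on components and on disjoint copies *)

(** Progress inside [C] depends only on the position inside [C]: this is simulation along the
    identity of [C]. *)
Lemma forces_local (V : finType) (W : pred {set V}) (C : {set V}) b k (M B M' B' : {set V}) :
  (forall M M' : {set V}, M \subset M' -> W M -> W M') ->
  M :&: C \subset M' -> B' :&: C \subset B ->
  forces (fun N => W (N :&: C)) b k M B -> forces (fun N => W (N :&: C)) b k M' B'.
Proof.
move=> mono /subsetP hM /subsetP hB.
apply: (@forces_sim _ _ (fun u v => (u == v) && (u \in C))).
- by move=> u u' v /andP[/eqP -> _] /andP[/eqP ->].
- by move=> u v v' /andP[/eqP <- _] /andP[/eqP <-].
- move=> N N' h; apply: mono; apply/subsetP => u; rewrite !inE => /andP[uN uC].
  by rewrite (h u u) // eqxx uC.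
- by move=> u v /andP[/eqP <- uC] uM; apply: hM; rewrite inE uM.
- by move=> u v /andP[/eqP -> uC] uM; apply: hB; rewrite inE uM.
Qed.

Lemma component_eq (V : finType) (e : rel V) x z :
  symmetric e -> x \in component e z -> component e z = component e x.
Proof.
move=> /sym_connect_sym se; rewrite inE => h; apply/setP => y; rewrite !inE.
by rewrite (same_connect se h).
Qed.

(* Breaker answers in the component where Maker has just played, so Maker wins
   the whole game only if he wins it inside one component. *)
Lemma forces_component (V : finType) (eG : rel V) (W : pred {set V}) b k (M B : {set V}) :
  symmetric eG ->
  (forall M M' : {set V}, M \subset M' -> W M -> W M') ->
  (forall M, W M -> exists z, W (M :&: component eG z)) ->
  forces W b k M B -> exists z, forces (fun N => W (N :&: component eG z)) b k M B.
Proof.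
move=> se mono split; elim: k M B => [|k IH] M B.
  by case=> // /split [z h]; exists z; left.
case=> [/split [z h]|[X [hX hd] h]]; first by exists z; left.
have [X0|/set0Pn [x xX]] := eqVneq X set0.
  have [||z hz] := IH _ _ (h set0 _ _); rewrite ?cards0 // -?setI_eq0 ?set0I //.
  by exists z; move: hz; rewrite X0 set0U setU0; apply: forces_leq.
have {xX} Xx : X = [set x].
  by apply/eqP; rewrite eq_sym eqEcard sub1set xX cards1.
(* The component found by induction depends on the reply [T]. If it is not that of [x], Maker's move
   changed nothing there and [T] only helped Breaker, so Maker was already winning there before the
   move. Excluding this case leaves the component of [x] for every [T]. *)
have [[z hz]|no] := EM (exists z, forces (fun N => W (N :&: component eG z)) b k M B).
  by exists z; apply: forces_leq hz.
exists x; right; exists X => // T hT hTd.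
have [z hz] := IH _ _ (h T hT hTd).
have [xz|xz] := boolP (x \in component eG z).
  by rewrite -(component_eq se xz).
case: no; exists z; apply: forces_local hz => //; last by apply: subset_trans (subsetIl _ _) (subsetUl _ _).
apply/subsetP => u; rewrite Xx !inE => /andP[/orP[/eqP ux|//] uz].
by rewrite inE -ux uz in xz.
Qed.

Lemma has_copy_component (VH : finType) (eH : rel VH) x (V : finType) (eG : rel V) (M : {set V}) :
  has_copy eH (component eH x) eG M ->
  exists z, has_copy eH (component eH x) eG (M :&: component eG z).
Proof.
move=> /has_copyP [f [h1 h2 h3]]; exists (f x); apply/has_copyP; exists f; split => //.
move=> y yx; rewrite inE h1 //= inE; move: yx; rewrite inE => /connectP [p hp ->].
elim/last_ind: p hp => [|p y' IH] /=; first by rewrite connect0.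
rewrite rcons_path last_rcons => /andP[hp hy].
apply: connect_trans (IH hp) (connect1 _).
have hl : connect eH x (last x p) by apply/connectP; exists p.
by apply: h3 (hy); rewrite inE //; apply: connect_trans hl (connect1 hy).
Qed.

(** Vertices are renamed to ordinals because the minimality of [v] is stated for trees on some
    ['I_m]. *)
Definition induced (V : finType) (e : rel V) (C : {set V}) : rel 'I_#|C| :=
  fun i j => e (enum_val i) (enum_val j).

Lemma induced_component_tree (V : finType) (e : rel V) z :
  simple_graph e -> acyclic e ->
  simple_graph (@induced V e (component e z)) /\ is_tree (@induced V e (component e z)).
Proof.
move=> [se ie] ae; set C := component e z.
have zC : z \in C by rewrite inE connect0.
split; first by split => [i j|i]; [apply: se|apply: ie].
split; first by rewrite card_ord; apply/card_gt0P; exists z.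
split; last first.
  move=> c uc sc; apply/negP => /(@homo_cycle _ _ (@enum_val _ (mem C)) _ e (fun _ _ h => h)).
  by apply/negP; apply: ae; rewrite ?size_map // map_inj_uniq //; apply: enum_val_inj.
move=> i j.
have : connect e (enum_val i) (enum_val j).
  have := enum_valP i; have := enum_valP j; rewrite !inE => h1 h2.
  by apply: connect_trans h1; rewrite (sym_connect_sym se).
case/connectP => p; elim: p i => [|w p IH] i /=.
  by move=> _ /enum_val_inj ->; rewrite connect0.
case/andP => hw hp hl.
have wC : w \in C.
  have := enum_valP i; rewrite !inE => h; exact: connect_trans h (connect1 hw).
have hr := enum_rankK_in zC wC.
apply: (@connect_trans _ _ (enum_rank_in zC w)).
  by apply: connect1; rewrite /induced hr.
by apply: IH; rewrite hr.
Qed.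

(** By contradiction, with [x] in the critical component of [eH]: a win of Maker for [eH] would be a
    win for that component, hence a win inside one component of [eG], a tree on fewer than [v]
    vertices. *)
Lemma breaker_wins_small_components (VH : finType) (eH : rel VH) x b v
    (V : finType) (eG : rel V) mf :
  0 < b -> simple_graph eG -> acyclic eG ->
  (forall z, #|component eG z| < v) ->
  (forall (m : nat) (eT' : rel 'I_m), simple_graph eT' -> is_tree eT' ->
     maker_wins eH (component eH x) b eT' true -> v <= m) ->
  breaker_wins eH [set: VH] b eG mf.
Proof.
move=> hb sG aG hv hmin; apply/negP => /maker_wins_forces.
set S := component eH x => hf.
have {hf} : forces (has_copy eH S eG) b #|V|.+1 set0 set0.
  apply: (@forces_sim _ _ (fun u v => u == v)) hf.
  - by move=> u u' w /eqP -> /eqP ->.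
  - by move=> u w w' /eqP <- /eqP <-.
  - by move=> N N' h; apply: has_copyS; rewrite ?subsetT //; apply/subsetP => u; apply: h.
  - by move=> u w; rewrite inE.
  - by move=> u w; rewrite inE.
have [se _] := sG.
case/(forces_component se); first by move=> M M'; apply: has_copyS.
  by move=> M; apply: has_copy_component.
move=> z hz; have [h1 h2] := induced_component_tree z sG aG.
have := hv z; rewrite ltnNge => /negP; apply; apply: hmin h1 h2 _.
have zC : z \in component eG z by rewrite inE connect0.
apply: (@forces_maker_first _ _ _ _ _ _ #|V|.+1) => //.
apply: (@forces_sim _ _ (fun u (i : 'I_#|component eG z|) => u == enum_val i)) hz.
- by move=> u u' i /eqP -> /eqP ->.
- by move=> u i j /eqP -> /eqP /enum_val_inj.
- move=> N N' h /has_copyP [f [f1 f2 f3]].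
  have fC y : y \in S -> f y \in component eG z by move=> /f1; rewrite inE => /andP[].
  have hr y : y \in S -> enum_val (enum_rank_in zC (f y)) = f y by move=> /fC /(enum_rankK_in zC).
  apply/has_copyP; exists (fun y => enum_rank_in zC (f y)); split.
  + move=> y yS; apply: (h (f y)); first by rewrite hr.
    by move: (f1 y yS); rewrite inE => /andP[].
  + by move=> y y' yS yS' e; apply: f2 => //; rewrite -hr // e hr.
  + by move=> y y' yS yS' e; rewrite /induced !hr //; apply: f3.
- by move=> u w; rewrite inE.
- by move=> u w; rewrite inE.
Qed.

Lemma has_copyU (VH : finType) (eH : rel VH) (S1 S2 : {set VH})
    (VG : finType) (eG : rel VG) (M1 M2 : {set VG}) :
  [disjoint M1 & M2] ->
  {in S1, forall x y, y \in S2 -> ~~ eH x y && ~~ eH y x} ->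
  has_copy eH S1 eG M1 -> has_copy eH S2 eG M2 -> has_copy eH (S1 :|: S2) eG (M1 :|: M2).
Proof.
move=> hd hS /has_copyP [f [f1 f2 f3]] /has_copyP [g [g1 g2 g3]].
have dis z : z \in M1 -> z \in M2 -> False.
  by move=> z1 z2; move/pred0P: hd => /(_ z) /=; rewrite z1 z2.
apply/has_copyP; exists (fun x => if x \in S1 then f x else g x); split.
- move=> x; rewrite !inE; case: (boolP (x \in S1)) => [/f1->//|_ /= /g1 ->].
  by rewrite orbT.
- move=> x y; rewrite !inE; case: (boolP (x \in S1)) => /= xS.
    case: (boolP (y \in S1)) => /= yS _ y2; first exact: f2.
    by move=> e; case: (dis (f x)); [exact: f1|rewrite e; exact: g1].
  case: (boolP (y \in S1)) => /= yS x2 y2; last exact: g2.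
  by move=> e; case: (dis (f y)); [exact: f1|rewrite -e; exact: g1].
- move=> x y; rewrite !inE; case: (boolP (x \in S1)) => /= xS.
    case: (boolP (y \in S1)) => /= yS _ y2; first exact: f3.
    by have /andP[/negbTE->] := hS x xS y y2.
  case: (boolP (y \in S1)) => /= yS x2 y2; last exact: g3.
  by have /andP[_ /negbTE->] := hS y yS x x2.
Qed.

(* Maker builds the components of [eH] one after the other, each inside a copy
   of its host tree that Breaker has not touched yet. *)
Lemma maker_wins_many_copies (VH : finType) (eH : rel VH) b v N
    (V : finType) (eG : rel V) (m : VH -> nat) (eT : forall x, rel 'I_(m x))
    (A : VH -> 'I_N -> {set V}) mf :
  0 < b -> symmetric eH -> (forall x, m x <= v) ->
  (forall x, maker_wins eH (component eH x) b (eT x) true) ->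
  (forall x j, has_copy (eT x) setT eG (A x j)) ->
  (forall x j x' j' z, z \in A x j -> z \in A x' j' -> x = x' /\ j = j') ->
  b + b * (v.+1 * #|VH|) < N ->
  maker_wins eH [set: VH] b eG mf.
Proof.
move=> hb sH hm hwin hcopy hdis hN.
(* [S d] is the part of [eH] already built. Its copy is kept inside [Rg d], the slots reserved for
   [d], and thus away from the slots of later vertices. *)
pose S (d : seq VH) := [set y | has (fun x => connect eH x y) d].
pose Rg (d : seq VH) := [set z | [exists x in d, [exists j, z \in A x j]]].
have main todo d (M B : {set V}) : uniq (todo ++ d) -> (forall x, x \in todo ++ d) ->
    has_copy eH (S d) eG (M :&: Rg d) -> #|B| <= b + b * (v.+1 * size d) ->
    forces (has_copy eH setT eG) b (v.+1 * size todo) M B.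
  elim: todo d M B => [|x todo IH] d M B /=.
    move=> _ hall hc _; apply: forces_now; apply: has_copyS hc; last exact: subsetIl.
    by apply/subsetP => y _; rewrite inE; apply/hasP; exists y => //; apply: connect0.
  case/andP => xtd utd hall hc hB.
  have uxd : uniq (todo ++ x :: d).
    by rewrite (uniq_catCA todo [:: x] d) /= xtd.
  have allxd y : y \in todo ++ x :: d.
    by have := hall y; rewrite !inE !mem_cat inE; case: (y == x); rewrite ?orbT //=.
  have hsz : size d < #|VH|.
    have := max_card (mem (todo ++ x :: d)); rewrite (card_uniqP uxd) size_cat /= addnS.
    by apply: leq_ltn_trans; apply: leq_addl.
  have SR : Rg d \subset Rg (x :: d).
    apply/subsetP => z; rewrite !inE => /exists_inP [x' xd' hj].
    by apply/exists_inP; exists x' => //; rewrite inE xd' orbT.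
  (* Components are named by their vertices, so that of [x] may have been built under another
     name. *)
  have [xS|xS] := boolP (x \in S d).
    have Sx : S (x :: d) \subset S d.
      apply/subsetP => y; rewrite !inE /= => /orP [hy|//].
      move: xS; rewrite inE => /hasP [x' xd' hx']; apply/hasP; exists x' => //.
      exact: connect_trans hx' hy.
    apply: (@forces_leq _ _ _ (v.+1 * size todo)); first by rewrite leq_mul2l leqW // orbT.
    apply: (IH (x :: d)) => //; last by apply: leq_trans hB _; rewrite /= leq_add2l !leq_mul2l leqW // !orbT.
    by apply: has_copyS hc => //; apply: setIS.
  (* The sets [A x j] are disjoint, so Breaker touches at most [#|B|] of them, and [N] exceeds the
     bound on [#|B|]. *)
  have [j hj] : exists j, [disjoint A x j & B].
    apply/existsP; apply: contraT; rewrite negb_exists => /forallP hno.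
    have : #|[set: 'I_N]| <= #|B|.
      apply: (@card_rel_image _ _ (fun j z => z \in A x j)).
        by move=> j j' z h1 h2; case: (hdis _ _ _ _ _ h1 h2).
      move=> j _; have /pred0Pn [z /= /andP[z1 z2]] := hno j; by exists z.
    rewrite cardsT card_ord => hNB; suff : #|B| <= b + b * (v.+1 * #|VH|) by lia.
    by apply: leq_trans hB _; rewrite leq_add2l !leq_mul2l ltnW ?orbT.
  rewrite mulnS.
  pose W1 := fun N0 : {set V} => has_copy eH (component eH x) eG (N0 :&: A x j).
  apply: (@forces_seq _ W1).
    have /maker_wins_forces := hwin x; rewrite card_ord => hf.
    have /has_copyP [phi [p1 p2 p3]] := hcopy x j.
    apply: (@forces_leq _ _ _ (m x).+1); first exact: hm.
    apply: (@forces_sim _ _ (fun u z => phi u == z)) hf.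
    - by move=> u u' z /eqP <- /eqP /p2 -> //; rewrite inE.
    - by move=> u z z' /eqP <- /eqP <-.
    - move=> N0 N1 h /has_copyP [f [f1 f2 f3]]; apply/has_copyP; exists (phi \o f); split.
      + by move=> y yx; rewrite inE (h (f y)) ?eqxx //= ?f1 // p1 // inE.
      + by move=> y y' yx yx' /= /p2; rewrite !inE => /(_ isT isT) /f2; apply.
      + by move=> y y' yx yx' e /=; apply: p3; rewrite ?inE //; apply: f3.
    - by move=> u z; rewrite inE.
    - by move=> u z /eqP <- ub; move/pred0P: hj => /(_ (phi u)) /=; rewrite ub p1 ?inE.
  move=> M' B' hM' hB' hW1; apply: (IH (x :: d)) => //; last first.
    by apply: leq_trans hB' _; rewrite /= [v.+1 * _.+1]mulnS mulnDr; lia.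
  have e1 : S (x :: d) = component eH x :|: S d by apply/setP => y; rewrite !inE.
  rewrite e1; apply: (@has_copyS _ _ _ _ _ _ ((M' :&: A x j) :|: (M' :&: Rg d))) => //.
    rewrite -setIUr setIS // subUset SR andbT; apply/subsetP => z zA; rewrite inE.
    by apply/exists_inP; exists x; rewrite ?mem_head //; apply/existsP; exists j.
  apply: has_copyU => //.
  - apply/pred0P => z /=; apply/negP; rewrite !inE => /andP[/andP[_ zA] /andP[_ /exists_inP [x' xd']]].
    case/existsP => j' zA'; have [xx _] := hdis _ _ _ _ _ zA zA'.
    by move: xtd; rewrite mem_cat xx xd' orbT.
  - move=> y; rewrite inE => hy w; rewrite inE => /hasP [x' xd' hw].
    rewrite [eH w y]sH andbb; apply: contra xS => e; rewrite inE; apply/hasP; exists x' => //.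
    apply: connect_trans hw _; rewrite (sym_connect_sym sH).
    exact: connect_trans hy (connect1 e).
  - by apply: has_copyS hc => //; apply: setSI.
apply: (@forces_maker_wins _ _ _ _ _ _ (v.+1 * size (enum VH))) => // B hB.
apply: (main _ [::]); rewrite ?cats0 ?enum_uniq //.
- by move=> x; rewrite mem_enum.
(* Even an empty copy is a total function from [VH] to [V], so [V] must be inhabited if [VH] is; a
   copied host tree provides a vertex. *)
- have /card_gt0P [f _] : 0 < #|{ffun VH -> V}|.
    rewrite card_ffun expn_gt0; have [_|/pred0Pn [x _]] := boolP (#|VH| == 0).
      by rewrite orbT.
    have j : 'I_N by exists 0; lia.
    have /has_copyP [phi [p1 _ _]] := hcopy x j.
    have /maker_wins_forces/forces_setT := hwin x.
    case/(_ _)/existsP => [M M'|g _]; first by apply: has_copyS.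
    by apply/orP; left; apply/card_gt0P; exists (phi (g x)).
  by apply/has_copyP; exists f; split => y; rewrite inE.
- by lia.
Qed.

(** * Growth orders of trees *)

(* The value of [par] at index [0] is irrelevant. *)
Definition growth (V : finType) (e : rel V) m (y : 'I_m -> V) (par : 'I_m -> 'I_m) : Prop :=
  injective y /\ forall i : 'I_m, 0 < i -> par i < i /\ e (y (par i)) (y i).

Lemma path_exit (V : finType) (e : rel V) (s : seq V) u p :
  path e u p -> u \in s -> last u p \notin s ->
  exists a c, [/\ a \in s, c \notin s & e a c].
Proof.
elim: p u => [|w p IH] u /=; first by move=> _ ->.
case/andP => huw hp us hl; have [ws|ws] := boolP (w \in s); first exact: IH hp ws hl.
by exists u, w.
Qed.

(** Some edge leaves every proper part of a component that contains [z], so a connected list grows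
    to any size up to that of the component. This serves for whole trees and for subtrees of
    prescribed size. *)
Lemma growth_exists (V : finType) (e : rel V) z m :
  m <= #|component e z| -> exists (y : 'I_m -> V) (par : 'I_m -> 'I_m), growth e y par.
Proof.
move=> hm.
suff [s [us ss sub hs]] : exists s : seq V, [/\ uniq s, size s = m,
    {subset s <= component e z} &
    forall i, 0 < i < m -> exists2 j, j < i & e (nth z s j) (nth z s i)].
  exists (fun i : 'I_m => nth z s i).
  exists (fun i : 'I_m => odflt i [pick j : 'I_m | (j < i) && e (nth z s j) (nth z s i)]); split.
    by move=> i j /eqP; rewrite nth_uniq ?ss // => /eqP/val_inj.
  move=> i i0; case: pickP => [j /andP[]//|/=].
  have [|j ji hj] := hs i; first by rewrite i0 ltn_ord.
  by move=> /(_ (Ordinal (ltn_trans ji (ltn_ord i)))) /=; rewrite ji hj.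
case: m hm => [|m hm]; first by exists [::]; split => // i; rewrite ltn0 andbF.
suff [s [us ss sub zs hs]] : exists s : seq V, [/\ uniq s, size s = m.+1,
    {subset s <= component e z}, z \in s &
    forall i, 0 < i < m.+1 -> exists2 j, j < i & e (nth z s j) (nth z s i)].
  by exists s.
elim: m hm => [|m IH] hm.
  exists [:: z]; split => //; last by case.
    by move=> x; rewrite !inE => /eqP ->; apply: connect0.
  by rewrite inE.
have [s [us ss sub zs hs]] := IH (ltnW hm).
have [w wC ws] : exists2 w, w \in component e z & w \notin s.
  apply/subsetPn; apply/negP => /subset_leq_card; rewrite (card_uniqP us) ss; lia.
move: wC; rewrite inE => /connectP [p hp ew].
have [|a [c [ha hc hac]]] := path_exit hp zs; first by rewrite -ew.
exists (rcons s c); split.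
- by rewrite rcons_uniq hc.
- by rewrite size_rcons ss.
- move=> x; rewrite mem_rcons inE => /orP [/eqP ->|/sub//].
  by have := sub a ha; rewrite !inE => h; apply: connect_trans h (connect1 hac).
- by rewrite mem_rcons inE zs orbT.
move=> i /andP[i0]; rewrite ltnS leq_eqVlt => /orP [/eqP ->|im].
  exists (index a s); first by rewrite -ss index_mem.
  by rewrite !nth_rcons ss ltnn eqxx -ss index_mem ha nth_index.
have [|j ji hj] := hs i; first by rewrite i0.
exists j => //; rewrite !nth_rcons ss im.
by rewrite (ltn_trans ji im).
Qed.

(** A second earlier neighbour [y j] of [y i] would be joined to [y (par i)] by a path of earlier
    vertices, closing a cycle through [y i]. *)
Lemma growth_unique (V : finType) (e : rel V) m (y : 'I_m -> V) (par : 'I_m -> 'I_m) :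
  symmetric e -> acyclic e -> growth e y par ->
  forall i j : 'I_m, j < i -> e (y j) (y i) -> j = par i.
Proof.
move=> se ae [yinj hpar] i j ji hji; apply/eqP; apply: contraT => jp.
have [|pi epi] := hpar i; first by lia.
pose S := [set y k | k : 'I_m & k < i].
have yS (k : 'I_m) : k < i -> y k \in S by move=> ki; apply: imset_f; rewrite inE.
pose eS := [rel a c | [&& a \in S, c \in S & e a c]].
have seS : connect_sym eS.
  by apply: sym_connect_sym => a c /=; rewrite se andbCA.
have i0 : 0 < m by apply: leq_trans (ltn_ord i).
have con k (hk : k < m) : k < i -> connect eS (y (Ordinal i0)) (y (Ordinal hk)).
  elim/ltn_ind: k hk => -[|k] IH hk ki; first by rewrite (bool_irrelevance hk i0) connect0.
  have [//|pk epk] := hpar (Ordinal hk).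
  have pkm : par (Ordinal hk) < m by [].
  have := IH (par (Ordinal hk)) pk pkm (ltn_trans pk ki).
  have -> : Ordinal pkm = par (Ordinal hk) by apply: val_inj.
  move=> h; apply: connect_trans h (connect1 _); rewrite /= epk !yS //.
  exact: ltn_trans pk ki.
have con' (k : 'I_m) : k < i -> connect eS (y (Ordinal i0)) (y k).
  by case: k => k hk; apply: con.
have : connect eS (y j) (y (par i)).
  by apply: (@connect_trans _ _ (y (Ordinal i0))); [rewrite seS|]; apply: con'.
case/connectP => p0 /shortenP [p hp up _] elast.
have pne : p != [::].
  by apply: contra jp => /eqP p0E; move: elast; rewrite p0E /= => /yinj ->.
have pS : all (mem S) p.
  elim: (p) (y j) hp => //= a p' IH u /andP[/and3P[_ aS _] /IH ->]; by rewrite aS.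
have hpe : path e (y j) p by apply: sub_path hp => a c /and3P[].
have niS : y i \notin S.
  by apply/negP => /imsetP [k]; rewrite inE => ki /yinj ik; move: ki; rewrite ik ltnn.
have := ae (y i :: y j :: p); rewrite cons_uniq up andbT => /(_ _ _)/negP; case.
- rewrite inE negb_or; apply/andP; split.
    by apply: contra niS => /eqP ->; apply: yS.
  by apply: contra niS => yip; move/allP: pS => /(_ _ yip).
- by case: (p) pne.
- by rewrite /= rcons_path hpe -elast epi se hji.
Qed.

Lemma tree_growth (V : finType) (e : rel V) :
  simple_graph e -> is_tree e ->
  exists (y : 'I_#|V| -> V) (par : 'I_#|V| -> 'I_#|V|),
    [/\ growth e y par, bijective y &
     forall i j : 'I_#|V|, e (y j) (y i) -> (0 < i) && (par i == j) || (0 < j) && (par j == i)].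
Proof.
move=> [se ie] [/card_gt0P [z _] [ce ae]].
have hz : #|V| <= #|component e z|.
  by rewrite -cardsT; apply: subset_leq_card; apply/subsetP => x _; rewrite inE.
have [y [par g]] := growth_exists hz.
exists y, par; split => //.
  by apply: inj_card_bij; [case: g|rewrite card_ord].
move=> i j hji; case: (ltngtP i j) => ij.
- by rewrite (growth_unique se ae g ij) ?eqxx ?(leq_trans _ ij) ?orbT // se.
- by rewrite (growth_unique se ae g ij hji) eqxx (leq_trans _ ij).
- by move: hji; rewrite (val_inj ij) ie.
Qed.

(** * Edge sets of placed trees *)

Definition spair n (x y : 'I_n) : 'I_n * 'I_n := if x < y then (x, y) else (y, x).

Lemma spair_upper n (x y : 'I_n) : x != y -> spair x y \in upper_pairs n.
Proof.
by rewrite inE /spair; case: (ltngtP x y) => //= h; rewrite (val_inj h) eqxx.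
Qed.

Lemma spair_inj n (x y x' y' : 'I_n) :
  spair x y = spair x' y' -> (x = x' /\ y = y') \/ (x = y' /\ y = x').
Proof. by rewrite /spair; do 2 case: ifP => _; case=> -> ->; auto. Qed.

Lemma adjE_spair n (E : {set 'I_n * 'I_n}) x y : spair x y \in E -> adjE E x y.
Proof. by rewrite /spair /adjE; case: ifP => _ ->; rewrite ?orbT. Qed.

Lemma spair_adjE n (E : {set 'I_n * 'I_n}) x y :
  E \subset upper_pairs n -> adjE E x y -> spair x y \in E.
Proof.
move=> /subsetP hE /orP [h|h]; have := hE _ h; rewrite inE /spair /=; first by move=> ->.
by case: (ltngtP x y).
Qed.

Lemma adjE_simple n (E : {set 'I_n * 'I_n}) : E \subset upper_pairs n -> simple_graph (adjE E).
Proof.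
move=> /subsetP hE; split; first by move=> x y; rewrite /adjE orbC.
by move=> x; apply/negP => /orP [] /hE; rewrite inE ltnn.
Qed.

(** The edges of the tree with parents [par], placed by [y]. Each edge is indexed by its endpoint
    other than the root, whence [m.-1] edges. *)
Definition conf n m (y : 'I_m -> 'I_n) (par : 'I_m -> 'I_m) : {set 'I_n * 'I_n} :=
  [set spair (y (par i)) (y i) | i : 'I_m & 0 < i].

Lemma conf_upper n m (y : 'I_m -> 'I_n) (par : 'I_m -> 'I_m) : injective y ->
  (forall i : 'I_m, 0 < i -> par i < i) -> conf y par \subset upper_pairs n.
Proof.
move=> yinj hp; apply/subsetP => x /imsetP [i]; rewrite inE => i0 ->; apply: spair_upper.
by apply/negP => /eqP /yinj h; have := hp i i0; rewrite h ltnn.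
Qed.

Lemma card_pos_ord m : #|[set i : 'I_m | 0 < i]| = m.-1.
Proof.
case: m => [|m]; first by apply: eq_card0; case.
rewrite -[RHS]/(m.+1.-1) -[in RHS](card_ord m.+1) -cardsT (cardsD1 ord0 setT) inE /= add0n.
by apply: eq_card => i; rewrite !inE andbT lt0n.
Qed.

Lemma conf_index_inj n m (y : 'I_m -> 'I_n) (par : 'I_m -> 'I_m) : injective y ->
  (forall i : 'I_m, 0 < i -> par i < i) ->
  {in [set i : 'I_m | 0 < i] &, injective (fun i => spair (y (par i)) (y i))}.
Proof.
move=> yinj hp i j; rewrite !inE => /hp h1 /hp h2 /spair_inj [] [/yinj e1 /yinj //].
by move=> e2; move: h1 h2; rewrite e1 e2; lia.
Qed.

Lemma card_conf n m (y : 'I_m -> 'I_n) (par : 'I_m -> 'I_m) : injective y ->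
  (forall i : 'I_m, 0 < i -> par i < i) -> #|conf y par| = m.-1.
Proof. by move=> yinj hp; rewrite card_in_imset ?card_pos_ord //; apply: conf_index_inj. Qed.

Lemma nedges_tree v (eT : rel 'I_v) :
  simple_graph eT -> is_tree eT -> nedges eT = v.-1.
Proof.
move=> sT tT; have [y [par []]] := tree_growth sT tT.
move: y par; rewrite card_ord => y par [yinj hp] [y' yK yK'] hu.
have [se ie] := sT.
rewrite /nedges -(card_conf yinj (fun i i0 => (hp i i0).1)).
apply: eq_card => -[a c]; rewrite inE /=; apply/andP/imsetP => [[ac eac]|[i]].
  have := hu (y' c) (y' a); rewrite !yK' => /(_ eac) /orP [] /andP [h0 /eqP h].
    by exists (y' c); rewrite ?inE // h !yK' /spair ac.
  by exists (y' a); rewrite ?inE // h !yK' /spair ltnNge (ltnW ac).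
rewrite inE => /hp [h1 h2]; rewrite /spair; case: (ltngtP (y (par i)) (y i)) => // h [-> ->] //.
  by rewrite se.
by move: h1; rewrite (yinj _ _ (val_inj h)) ltnn.
Qed.

Lemma conf_has_copy n m (eT : rel 'I_m) (E : {set 'I_n * 'I_n}) (A : {set 'I_n})
   (y0 : 'I_m -> 'I_m) (par : 'I_m -> 'I_m) (y : 'I_m -> 'I_n) :
  bijective y0 ->
  (forall i j, eT (y0 j) (y0 i) -> (0 < i) && (par i == j) || (0 < j) && (par j == i)) ->
  injective y -> (forall i, y i \in A) -> conf y par \subset E ->
  has_copy eT setT (adjE E) A.
Proof.
move=> [y' yK yK'] hu yinj yA /subsetP hE.
have hadj i : 0 < nat_of_ord i -> adjE E (y (par i)) (y i).
  by move=> i0; apply: adjE_spair; apply: hE; apply: imset_f; rewrite inE.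
apply/has_copyP; exists (y \o y'); split => //.
- by move=> x _; apply: yA.
- by move=> a c _ _ /yinj /(can_inj yK').
- move=> a c _ _ eac /=; have := hu (y' c) (y' a); rewrite !yK' => /(_ eac) /orP [] /andP[h0 /eqP <-].
    exact: hadj.
  by rewrite /adjE orbC; exact: hadj.
Qed.

Lemma parent_graph_tree N (par : nat -> nat) (e := fun x y : 'I_N =>
    ((0 < x) && (par x == y)) || ((0 < y) && (par y == x))) :
  0 < N -> (forall i, 0 < i -> par i < i) -> simple_graph e /\ is_tree e.
Proof.
move=> N0 hp.
have se : symmetric e by move=> x y; rewrite /e orbC.
split.
  split => // x; apply/negP; rewrite /e orbb => /andP[x0 /eqP h].
  by have := hp x x0; rewrite h ltnn.
split; first by rewrite card_ord.
split.
  have h0 (x : 'I_N) : connect e (Ordinal N0) x.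
    case: x => k hk; elim/ltn_ind: k hk => -[|k] IH hk.
      by rewrite (bool_irrelevance hk N0) connect0.
    have pk := hp k.+1 isT.
    apply: connect_trans (IH _ pk (ltn_trans pk hk)) (connect1 _).
    by rewrite /e /= eqxx orbT.
  by move=> x y; apply: (@connect_trans _ _ (Ordinal N0)); rewrite // (sym_connect_sym se).
move=> c uc sc; apply/negP => hc.
have [x0 x0c] : exists x, x \in c by case: (c) sc => // a c' _; exists a; rewrite mem_head.
(* The largest vertex of a cycle would have its parent as both neighbours. *)
have [x xc xmax] := @arg_maxnP _ x0 [in c] val x0c.
have [i c' rotE] := rot_to xc.
move: (hc) uc sc; rewrite -(rot_cycle i) -(rot_uniq i) -(size_rot i) rotE.
have mem' z : z \in c' -> z <= x.
  by move=> zc; apply: xmax; rewrite -(mem_rot i) rotE inE zc orbT.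
case/lastP: c' {rotE} mem' => // -[//|u c'] w mem' /=.
rewrite !rcons_path last_rcons => /andP[exu /andP[_ ewx]] /andP[].
rewrite !inE !negb_or mem_rcons inE negb_or => /andP[xu /andP[xw _]] /andP[uw _] _.
have hu : u <= x by apply: mem'; rewrite mem_rcons !inE eqxx orbT.
have hw : w <= x by apply: mem'; rewrite mem_rcons inE eqxx.
have pu : par x = u.
  case/orP: exu => /andP[h1 /eqP h2] //; have := hp _ h1; lia.
have pw : par x = w.
  case/orP: ewx => /andP[h1 /eqP h2] //; have := hp _ h1; lia.
by move: uw; rewrite mem_rcons inE negb_or => /andP[/eqP []]; apply: val_inj; rewrite /= -pu pw.
Qed.

(** * A tree on which Maker wins *)

(* On a [K]-ary tree numbered as a heap Maker embeds [eH] greedily in a growth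
   order: fewer than [K] vertices are ever claimed, so the image of the parent
   always has a free child. *)
Lemma maker_wins_on_tree (b : nat) (VH : finType) (eH : rel VH) :
  0 < b -> simple_graph eH -> is_tree eH ->
  exists (m : nat) (eT : rel 'I_m),
    simple_graph eT /\ is_tree eT /\ maker_wins eH [set: VH] b eT true.
Proof.
move=> hb sH tH; have [y [par [[yinj hpar] [y' yK yK'] hu]]] := tree_growth sH tH.
have {}hpar i : 0 < nat_of_ord i -> par i < i by move=> /hpar [].
set h := #|VH| in y par yinj hpar y' yK yK' hu *.
(* Before each of the [h] moves at most [b.+1 * h] vertices are claimed, so one of [K] children is
   free. The children of q are K q + 1, ..., K q + K; if q is below (K+1)^j, they are below
   (K+1)^(j+1), so [N] vertices suffice. *)
pose K := (b.+1 * h).+1; pose N := K.+1 ^ h.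
pose parN i := i.-1 %/ K.
have hparN i : 0 < i -> parN i < i.
  by move=> i0; apply: leq_ltn_trans (leq_div _ _) _; lia.
have N0 : 0 < N by rewrite expn_gt0.
have [sT tT] := parent_graph_tree N0 hparN.
set e := (fun x y : 'I_N => _) in sT tT.
have [se _] := sT.
exists N, e; split => //; split => //; apply: (@forces_maker_first _ _ _ _ _ _ h) => //.
suff main d i (f : 'I_h -> 'I_N) (M B : {set 'I_N}) : i + d = h ->
    (forall k k' : 'I_h, k < i -> k' < i -> f k = f k' -> k = k') ->
    (forall k : 'I_h, k < i -> f k \in M) ->
    (forall k : 'I_h, k < i -> f k < K.+1 ^ k) ->
    (forall k : 'I_h, 0 < k < i -> e (f (par k)) (f k)) ->
    #|M| <= i -> #|B| <= b * i -> forces (has_copy eH setT e) b d M B.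
  by apply: (main h 0 (fun _ => Ordinal N0)); rewrite ?cards0 // => k; rewrite ltn0 andbF.
elim: d i f M B => [|d IH] i f M B hi finj fM fK fe cM cB.
  rewrite addn0 in hi; apply: forces_now; apply/has_copyP; exists (f \o y'); split => //.
  - by move=> x _; apply: fM; rewrite hi.
  - move=> x x' _ _ /finj; rewrite hi => /(_ (ltn_ord _) (ltn_ord _)); exact: (can_inj yK').
  - move=> x x' _ _ exx /=; have := hu (y' x') (y' x); rewrite !yK' => /(_ exx).
    case/orP => /andP[k0 /eqP <-]; last rewrite se; apply: fe; rewrite k0 hi; exact: ltn_ord.
have ih : i < h by lia.
pose oi := Ordinal ih.
have [c [cK cMB ce]] : exists c : 'I_N, [/\ c < K.+1 ^ i, c \notin M :|: B &
    0 < i -> e (f (par oi)) c].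
  case: (posnP i) => [i0|i0].
    exists (Ordinal N0); split; rewrite ?i0 //.
    have -> : M :|: B = set0.
      by apply/eqP; rewrite -cards_eq0; have := cardsUI M B; nia.
    by rewrite inE.
  have pi : par oi < i := hpar oi i0.
  have hp : f (par oi) < K.+1 ^ (par oi) by apply: fK.
  have hlt (t : 'I_K) : K * f (par oi) + t.+1 < K.+1 ^ i.
    have : K.+1 ^ (par oi).+1 <= K.+1 ^ i by rewrite leq_exp2l.
    have := ltn_ord t; rewrite expnS; set P := K.+1 ^ _ in hp *; set Q := K.+1 ^ i.
    by move: (f (par oi) : nat) hp => q hp; nia.
  have hN (t : 'I_K) : K * f (par oi) + t.+1 < N.
    by apply: leq_trans (hlt t) _; rewrite leq_exp2l // ltnW.
  pose g t := Ordinal (hN t).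
  have ginj : injective g by move=> t t' /(congr1 val) /= h0; apply: val_inj => /=; lia.
  have /subsetPn [_ /imsetP [t _ ->] gt] : ~~ (g @: setT \subset M :|: B).
    apply/negP => /subset_leq_card; rewrite card_imset // cardsT card_ord.
    have hMB : #|M :|: B| <= i + b * i by have := cardsUI M B; lia.
    have hih : i + b * i <= b.+1 * h by rewrite -mulSn leq_mul2l ltnW ?orbT.
    by move/leq_trans => /(_ _ hMB) /leq_trans /(_ hih); rewrite ltnn.
  exists (g t); split => //; first exact: hlt.
  move=> _; rewrite /e /parN /= addnS /=; apply/orP; right.
  by rewrite mulnC divnMDl // divn_small ?addn0 ?eqxx.
have [cM' cB'] : c \notin M /\ c \notin B by apply/andP; rewrite -negb_or -in_setU.
right; exists [set c]; first by rewrite cards1 disjoints1.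
move=> T hT hd.
pose f' k := if k == oi then c else f k.
have f'lt (k : 'I_h) : k < i -> f' k = f k.
  by move=> ki; rewrite /f'; case: eqP => // koi; move: ki; rewrite koi /= ltnn.
have split (k : 'I_h) : k < i.+1 -> k = oi \/ k < i.
  by rewrite ltnS leq_eqVlt => /orP [/eqP ki|]; [left; apply: val_inj|right].
have f'oi : f' oi = c by rewrite /f' eqxx.
apply: (IH i.+1 f') => //.
- lia.
- move=> k k' /split [->|ki] /split [->|ki'] //; rewrite ?f'oi ?f'lt //.
  + by move=> ec; move: cM'; rewrite ec fM.
  + by move=> ec; move: cM'; rewrite -ec fM.
  + exact: finj.
- move=> k /split [->|ki]; rewrite ?f'oi ?f'lt // !inE ?eqxx //.
  by rewrite fM ?orbT.
- by move=> k /split [->|ki]; rewrite ?f'oi ?f'lt //; apply: fK.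
- move=> k /andP[k0 /split [koi|ki]].
    rewrite koi f'oi f'lt; last by apply: hpar; rewrite -koi.
    by apply: ce; rewrite koi in k0.
  rewrite !f'lt //; last exact: ltn_trans (hpar _ k0) ki.
  by apply: fe; rewrite k0.
- by rewrite cardsU1 cM'.
- by rewrite mulnS addnC; apply: leq_trans (leq_card_setU _ _) _; apply: leq_add.
Qed.

(** * The binomial random graph *)

Import Order.TTheory GRing.Theory Num.Theory.
Local Open Scope ring_scope.

Lemma card_upper_pairs n : #|upper_pairs n| = 'C(n, 2).
Proof.
rewrite -bin2_sum big_mkord -sum1_card.
rewrite (eq_bigl (fun u : 'I_n * 'I_n => (u.1 < u.2)%N)); last by move=> u; rewrite inE.
rewrite -(pair_big_dep xpredT (fun i j : 'I_n => (i < j)%N) (fun _ _ => 1%N)) /=.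
rewrite (exchange_big_dep xpredT) //=; apply: eq_bigr => j _.
rewrite sum1_card -[RHS]card_ord.
have winj : injective (widen_ord (ltnW (ltn_ord j))).
  by move=> a c /(congr1 val) /= /val_inj.
rewrite -(card_imset _ winj).
apply: eq_card => i; apply/idP/imsetP => [ij|[k _ ->]]; last exact: (ltn_ord k).
by exists (Ordinal (ij : (i < j)%N)) => //; apply: val_inj.
Qed.

(** The sum defining [PrGnp], for events on edge sets and in a form to which the algebra of big
    operators applies. *)
Definition Pr (F : realFieldType) n (p : F) (Q : pred {set 'I_n * 'I_n}) : F :=
  \sum_(E : {set 'I_n * 'I_n} | (E \subset upper_pairs n) && Q E)
     p ^+ #|E| * (1 - p) ^+ ('C(n, 2) - #|E|).

Lemma Pr_superset (F : realFieldType) n (p : F) (D : {set 'I_n * 'I_n}) :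
  D \subset upper_pairs n -> Pr p (fun E => D \subset E) = p ^+ #|D|.
Proof.
move=> DU; set U := upper_pairs n in DU *.
(* The sum expands the product of the factors [f i + g i], each equal to [p] on [D] and to 1
   elsewhere. The zeros of [f] and [g] remove the sets that leave [U] or miss part of [D]. *)
pose f i := if i \in U then p else 0.
pose g i := if i \in D then 0 else if i \in U then 1 - p else 1.
transitivity (\sum_(E : {set 'I_n * 'I_n}) \prod_i (if i \in E then f i else g i)).
  rewrite /Pr big_mkcond; apply: eq_bigr => E _; case: ifP => [/andP[EU DE]|].
    rewrite [RHS](bigID (mem E)) /=; congr (_ * _).
      rewrite -prodr_const; apply: eq_bigr => i iE.
      by rewrite iE /f (subsetP EU).
    rewrite -card_upper_pairs -/U -(setIidPr EU) -cardsD -prodr_const (setIidPr EU).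
    rewrite big_mkcond [RHS]big_mkcond; apply: eq_bigr => i _.
    rewrite inE /g; case: (boolP (i \in E)) => //= iE.
    by have /negbTE -> : i \notin D by apply: contra iE => /(subsetP DE).
  move/negbT; rewrite negb_and => /orP [] /subsetPn [i i1 i2].
    by rewrite (bigD1 i) //= i1 /f (negbTE i2) mul0r.
  by rewrite (bigD1 i) //= (negbTE i2) /g i1 mul0r.
rewrite -bigA_distr -prodr_const [RHS]big_mkcond; apply: eq_bigr => i _.
rewrite /f /g /=; case: (boolP (i \in D)) => iD; first by rewrite (subsetP DU) // addr0.
by case: (i \in U); rewrite ?add0r // addrCA subrr addr0.
Qed.

Lemma Pr_true (F : realFieldType) n (p : F) : Pr p (fun _ : {set 'I_n * 'I_n} => true) = 1.
Proof.
have := @Pr_superset F n p set0 (sub0set _); rewrite cards0 expr0 => <-.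
by apply: eq_bigl => E; rewrite sub0set.
Qed.

Lemma Pr_weight_ge0 (F : realFieldType) (p : F) i j : 0 <= p <= 1 -> 0 <= p ^+ i * (1 - p) ^+ j.
Proof. by move=> /andP[p0 p1]; rewrite mulr_ge0 ?exprn_ge0 // subr_ge0. Qed.

Lemma Pr_ge0 (F : realFieldType) n (p : F) (Q : pred {set 'I_n * 'I_n}) :
  0 <= p <= 1 -> 0 <= Pr p Q.
Proof. by move=> hp; apply: sumr_ge0 => E _; apply: Pr_weight_ge0. Qed.

Lemma Pr_predC (F : realFieldType) n (p : F) (Q : pred {set 'I_n * 'I_n}) :
  Pr p Q = 1 - Pr p (fun E => ~~ Q E).
Proof.
have h : Pr p Q + Pr p (fun E => ~~ Q E) = 1.
  rewrite -[RHS](Pr_true n p) /Pr [RHS](bigID Q) /=.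
  by congr (_ + _); apply: eq_bigl => E; rewrite andbT.
by rewrite -h addrK.
Qed.

Lemma Pr_mono (F : realFieldType) n (p : F) (Q Q' : pred {set 'I_n * 'I_n}) :
  0 <= p <= 1 -> (forall E : {set 'I_n * 'I_n}, E \subset upper_pairs n -> Q E -> Q' E) -> Pr p Q <= Pr p Q'.
Proof.
move=> hp h; rewrite /Pr big_mkcond [leRHS]big_mkcond; apply: ler_sum => E _.
case: ifP => [/andP[EU QE]|_]; first by rewrite EU h.
by case: ifP => // _; apply: Pr_weight_ge0.
Qed.

Lemma Pr_union (F : realFieldType) n (p : F) (I : finType) (P : pred I)
    (Q : I -> pred {set 'I_n * 'I_n}) :
  0 <= p <= 1 -> Pr p (fun E => [exists t, P t && Q t E]) <= \sum_(t | P t) Pr p (Q t).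
Proof.
move=> hp; rewrite /Pr.
under [leRHS]eq_bigr do rewrite big_mkcond /=.
rewrite exchange_big /= big_mkcond; apply: ler_sum => E _.
have w0 := @Pr_weight_ge0 F p #|E| ('C(n, 2) - #|E|) hp.
case: ifP => [/andP[EU /existsP [t /andP[Pt Qt]]]|_].
  rewrite (bigD1 t) //= EU Qt lerDl sumr_ge0 // => i _.
  by case: ifP.
by apply: sumr_ge0 => i _; case: ifP.
Qed.

Lemma Pr_first_moment (F : realFieldType) n (p : F) (I : finType) (P : pred I)
    (D : I -> {set 'I_n * 'I_n}) e :
  0 <= p <= 1 -> (forall t, P t -> D t \subset upper_pairs n /\ #|D t| = e) ->
  Pr p (fun E => [exists t, P t && (D t \subset E)]) <= #|I|%:R * p ^+ e.
Proof.
move=> hp hD; apply: le_trans (Pr_union _ _ hp) _.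
rewrite mulr_natl -sumr_const big_mkcond /=; apply: ler_sum => t _.
case: ifP => [/hD [h1 <-]|_]; first by rewrite Pr_superset.
by case/andP: hp => p0 _; rewrite exprn_ge0.
Qed.

(* Chebyshev's inequality for the number of sets [D t] contained in [E]. *)
Lemma Pr_second_moment (F : realFieldType) n (p : F) (I : finType)
    (D : I -> {set 'I_n * 'I_n}) e :
  0 <= p <= 1 -> (forall t, D t \subset upper_pairs n) -> (forall t, #|D t| = e) ->
  Pr p (fun E => [forall t, ~~ (D t \subset E)]) * (#|I|%:R * p ^+ e) ^+ 2 <=
  \sum_t \sum_t' (p ^+ #|D t :|: D t'| - p ^+ (e + e)).
Proof.
move=> hp DU De; set mu := #|I|%:R * p ^+ e.
pose w (E : {set 'I_n * 'I_n}) := p ^+ #|E| * (1 - p) ^+ ('C(n, 2) - #|E|).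
pose X (E : {set 'I_n * 'I_n}) : F := \sum_t (D t \subset E)%:R.
have EI (Q : pred {set 'I_n * 'I_n}) :
    \sum_(E : {set 'I_n * 'I_n} | E \subset upper_pairs n) w E * (Q E)%:R = Pr p Q.
  rewrite /Pr [RHS]big_mkcondr; apply: eq_bigr => E _.
  by case: (Q E); rewrite ?mulr1 ?mulr0.
have E1 : \sum_(E : {set 'I_n * 'I_n} | E \subset upper_pairs n) w E * X E = mu.
  under eq_bigr do rewrite mulr_sumr.
  rewrite exchange_big /=.
  under eq_bigr do rewrite (EI (fun E => D _ \subset E)) Pr_superset // De.
  by rewrite sumr_const -mulr_natl.
have E2 : \sum_(E : {set 'I_n * 'I_n} | E \subset upper_pairs n) w E * (X E * X E) =
    \sum_t \sum_t' p ^+ #|D t :|: D t'|.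
  under eq_bigr do rewrite mulr_suml mulr_sumr.
  rewrite exchange_big /=; apply: eq_bigr => t _.
  under eq_bigr do rewrite mulr_sumr mulr_sumr.
  rewrite exchange_big /=; apply: eq_bigr => t' _.
  rewrite -(@Pr_superset F n p) ?subUset ?DU // -EI; apply: eq_bigr => E _.
  by rewrite subUset -natrM mulnb.
have E0 : \sum_(E : {set 'I_n * 'I_n} | E \subset upper_pairs n) w E = 1.
  by rewrite -(Pr_true n p) -(EI (fun _ => true)); under [RHS]eq_bigr do rewrite mulr1.
have hmu : \sum_(t : I) \sum_(t' : I) p ^+ (e + e) = mu ^+ 2.
  by rewrite !sumr_const -mulrnA -mulr_natl natrM /mu exprD expr2 [RHS]mulrACA.
(* The right-hand side is the variance of [X], whose mean is [mu]; where no [D t] occurs, [X]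
   vanishes and the squared deviation is [mu ^+ 2]. *)
have -> : \sum_t \sum_t' (p ^+ #|D t :|: D t'| - p ^+ (e + e)) =
   \sum_(E : {set 'I_n * 'I_n} | E \subset upper_pairs n) w E * (X E - mu) ^+ 2.
  transitivity ((\sum_t \sum_t' p ^+ #|D t :|: D t'|) - mu ^+ 2).
    under eq_bigr do rewrite sumrB.
    by rewrite sumrB hmu.
  transitivity (\sum_(E : {set 'I_n * 'I_n} | E \subset upper_pairs n)
      (w E * (X E * X E) - 2 * mu * (w E * X E) + mu ^+ 2 * w E)).
    rewrite big_split sumrB /= -!mulr_sumr E0 E1 E2 -addrA; congr (_ + _).
    by move: (mu) => z; ring.
  by apply: eq_bigr => E _; move: (mu) (w E) (X E) => z u x; ring.
rewrite -EI mulr_suml; apply: ler_sum => E EU; rewrite -mulrA ler_wpM2l //.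
  exact: Pr_weight_ge0.
case: (boolP [forall t, _]) => [/forallP h|_]; last by rewrite mul0r sqr_ge0.
rewrite mul1r /X big1 ?sub0r ?sqrrN // => t _.
by rewrite (negbTE (h t)).
Qed.

(** * Second moment for copies of a tree *)

Lemma card_agree (I J : finType) (A : {set I}) (t : {ffun I -> J}) :
  #|[set t' : {ffun I -> J} | [forall i in A, t' i == t i]]| = (#|J| ^ (#|I| - #|A|))%N.
Proof.
pose Fm i := [pred j | (i \in A) ==> (j == t i)].
have -> : #|[set t' : {ffun I -> J} | [forall i in A, t' i == t i]]| = #|family Fm|.
  apply: eq_card => t'; rewrite inE; apply/forallP/familyP => h i; have := h i; by rewrite inE.
rewrite card_family foldrE big_map big_enum /= (bigID (mem A)) /= big1 ?mul1n; last first.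
  by move=> i iA; rewrite -(card1 (t i)); apply: eq_card => j; rewrite !inE iA.
rewrite (eq_bigr (fun _ => #|J|)).
  rewrite prod_nat_const; congr (_ ^ _)%N; rewrite -[#|I|](cardC A); apply/eqP.
  by rewrite addKn.
by move=> i iA; apply: eq_card => j; rewrite !inE (negbTE iA).
Qed.

(** The least element of [A] has no parent in [A]. This bounds the edges shared by two placements
    that agree on [A]. *)
Lemma card_parent_closed m (par : 'I_m -> 'I_m) (A : {set 'I_m}) :
  (forall i : 'I_m, (0 < i)%N -> (par i < i)%N) ->
  (#|[set i in A | (0 < i)%N && (par i \in A)]| <= #|A|.-1)%N.
Proof.
move=> hp; have [->|/set0Pn [a aA]] := eqVneq A set0.
  by rewrite cards0 leqn0 cards_eq0; apply/eqP/setP => i; rewrite !inE.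
have [x xA xmin] := @arg_minnP _ a [in A] val aA.
rewrite (cardsD1 x A) xA /=; apply: subset_leq_card; apply/subsetP => i.
rewrite !inE => /and3P[iA i0 piA]; rewrite iA andbT; apply/negP => /eqP ix.
by have := xmin _ piA; have := hp i i0; rewrite /= ix; lia.
Qed.

(* The vertex [i] of the tree is only placed in the residue class [c0 + i]
   modulo [L], so two placements share an edge of the tree exactly when they
   agree at both of its endpoints. *)
Lemma Pr_no_tree_copy (F : realFieldType) n (p : F) L c0 m q (eT : rel 'I_m) (Z : F) :
  0 <= p <= 1 -> simple_graph eT -> is_tree eT ->
  (0 < q)%N -> (q * L <= n)%N -> (c0 + m <= L)%N -> 0 < Z ->
  (forall a, (2 <= a <= m)%N -> Z <= q%:R ^+ a * p ^+ a.-1) ->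
  Pr p (fun E => ~~ has_copy eT setT (adjE E) [set x : 'I_n | (c0 <= x %% L < c0 + m)%N]) * Z
    <= 2 ^+ m.
Proof.
move=> hp sT tT q0 hqL hcL Z0 hZ.
have [y0 [par []]] := tree_growth sT tT.
move: y0 par; rewrite card_ord => y0 par [_ hpar] y0bij hu.
have {}hpar i : (0 < nat_of_ord i)%N -> (par i < i)%N by move=> /hpar [].
have m0 : (0 < m)%N by case: tT; rewrite card_ord.
have plt (t : 'I_q) (i : 'I_m) : (t * L + (c0 + i) < n)%N.
  apply: leq_trans hqL; apply: (@leq_trans (t.+1 * L)%N); last by rewrite leq_mul2r ltn_ord orbT.
  by rewrite mulSn addnC ltn_add2r; apply: leq_trans hcL; rewrite ltn_add2l.
pose y (t : {ffun 'I_m -> 'I_q}) i := Ordinal (plt (t i) i).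
have cL (i : 'I_m) : (c0 + i < L)%N by apply: leq_trans hcL; rewrite ltn_add2l.
have L0 : (0 < L)%N by apply: leq_trans (cL (Ordinal m0)).
have yE t t' i j : y t i = y t' j -> i = j /\ t i = t' j.
  move=> /(congr1 val) /= e; split; apply: val_inj.
    have := congr1 (modn^~ L) e; rewrite /= !modnMDl !modn_small //; lia.
  have := congr1 (divn^~ L) e; rewrite /= !divnMDl // !divn_small //; lia.
have yinj t : injective (y t) by move=> i j /yE [].
pose D t := conf (y t) par.
have DU t : D t \subset upper_pairs n by apply: conf_upper.
have De t : #|D t| = m.-1 by apply: card_conf.
pose agree (t t' : {ffun 'I_m -> 'I_q}) := [set i | t' i == t i].
have Dcap t t' : (#|D t :&: D t'| <= #|agree t t'|.-1)%N.
  apply: leq_trans (card_parent_closed (agree t t') hpar).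
  apply: leq_trans (leq_imset_card (fun i => spair (y t (par i)) (y t i)) _).
  apply: subset_leq_card; apply/subsetP => u; rewrite inE => /andP[].
  case/imsetP => i; rewrite inE => i0 ->; case/imsetP => j; rewrite inE => j0 e.
  have hi := hpar i i0; have hj := hpar j j0.
  apply: imset_f; rewrite !inE i0 /=.
  case/spair_inj: e => -[/yE [e1 e2] /yE [e3 e4]].
    by rewrite e2 e4 e1 e3 !eqxx.
  by move: hi hj; rewrite e1 e3; lia.
have p0 : 0 <= p by case/andP: hp.
set P := Pr p _.
have hP : P <= Pr p (fun E => [forall t, ~~ (D t \subset E)]).
  apply: Pr_mono => // E _; apply: contraR; rewrite negb_forall => /existsP [t]; rewrite negbK.
  apply: (conf_has_copy y0bij hu (yinj t)) => i; rewrite inE /= modnMDl modn_small //.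
  by rewrite leq_addr ltn_add2l ltn_ord.
set e := m.-1 in De.
have Ap (A : {set 'I_m}) : (#|A| <= m)%N by rewrite -[m in (_ <= m)%N]card_ord max_card.
pose mu : F := (q ^ m)%:R * p ^+ e.
have mu0 : 0 < mu.
  apply: mulr_gt0; first by rewrite ltr0n expn_gt0 q0.
  case: (ltngtP 1 m) => hm.
  - have := hZ m; rewrite hm leqnn => /(_ isT) h.
    have : 0 < q%:R ^+ m * p ^+ m.-1 by apply: lt_le_trans h.
    by rewrite pmulr_rgt0 // exprn_gt0 // ltr0n.
  - by lia.
  - by rewrite /e -hm expr0.
(* Placements that agree in at most one vertex share no edge and contribute zero. Otherwise their
   agreement set occurs among the [A]; the other terms are nonnegative. *)
have main : \sum_t \sum_t' (p ^+ #|D t :|: D t'| - p ^+ (e + e)) <=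
    \sum_(A : {set 'I_m} | (2 <= #|A|)%N) \sum_(t : {ffun 'I_m -> 'I_q})
       \sum_(t' : {ffun 'I_m -> 'I_q} | [forall i in A, t' i == t i]) p ^+ (e + e - #|A|.-1).
  rewrite [leRHS]exchange_big /=; apply: ler_sum => t _.
  under [leRHS]eq_bigr do rewrite big_mkcond /=.
  rewrite [leRHS]exchange_big /=; apply: ler_sum => t' _.
  have t0 (A : {set 'I_m}) : 0 <= (if [forall i in A, t' i == t i] then p ^+ (e + e - #|A|.-1) else 0).
    by case: ifP => // _; rewrite exprn_ge0.
  have hcard := cardsUI (D t) (D t'); rewrite !De in hcard.
  have hc := Dcap t t'.
  case: (leqP 2 #|agree t t'|) => h2.
    rewrite (bigD1 (agree t t')) //= ifT; last by apply/forall_inP => i; rewrite inE.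
    rewrite -[leLHS]addr0 lerD //.
      rewrite lerBlDr (@le_trans _ _ (p ^+ (e + e - #|agree t t'|.-1))) ?lerDl ?exprn_ge0 //.
      by apply: ler_wiXn2l; [|case/andP: hp|rewrite leq_subLR -hcard addnC leq_add2r].
    by apply: sumr_ge0.
  have cap0 : #|D t :&: D t'| = 0%N.
    by apply/eqP; rewrite -leqn0; apply: leq_trans hc _; case: #|agree t t'| h2 => [|[]].
  rewrite cap0 addn0 in hcard; rewrite hcard.
  by rewrite subrr sumr_ge0.
(* By [hZ] at [a = #|A|] each [A] contributes at most [mu ^+ 2 / Z]; the factor [2 ^+ m] of the
   conclusion counts the sets [A]. *)
have cnt (A : {set 'I_m}) : (2 <= #|A|)%N ->
    (\sum_(t : {ffun 'I_m -> 'I_q}) \sum_(t' : {ffun 'I_m -> 'I_q} | [forall i in A, t' i == t i]) p ^+ (e + e - #|A|.-1)) * Z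
    <= mu ^+ 2.
  move=> hA.
  have hs (t : {ffun 'I_m -> 'I_q}) (c : F) :
      \sum_(t' : {ffun 'I_m -> 'I_q} | [forall i in A, t' i == t i]) c = c *+ q ^ (m - #|A|).
    have := card_agree A t; rewrite !card_ord => <-.
    by rewrite -sumr_const; apply: eq_bigl => t'; rewrite inE.
  under eq_bigr do rewrite hs.
  rewrite sumr_const card_ffun !card_ord -mulrnA -mulr_natl.
  apply: (@le_trans _ _ ((q ^ (m - #|A|) * q ^ m)%:R * p ^+ (e + e - #|A|.-1) *
     (q%:R ^+ #|A| * p ^+ #|A|.-1))).
    rewrite ler_wpM2l ?hZ ?hA ?Ap //; apply: mulr_ge0; rewrite ?ler0n ?exprn_ge0 //.
  rewrite mulrACA -natrX -natrM -exprD.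
  have -> : (q ^ (m - #|A|) * q ^ m * q ^ #|A| = q ^ m * q ^ m)%N.
    by rewrite mulnAC -expnD subnK.
  have -> : (e + e - #|A|.-1 + #|A|.-1 = e + e)%N by have := Ap A; rewrite /e; lia.
  by rewrite /mu expr2 natrM exprD mulrACA.
have := Pr_second_moment hp DU De; rewrite card_ffun !card_ord -/mu => hsec.
have mu2 : 0 < mu ^+ 2 by rewrite exprn_gt0.
rewrite -(ler_pM2r mu2) mulrAC.
apply: (@le_trans _ _ ((\sum_t \sum_t' (p ^+ #|D t :|: D t'| - p ^+ (e + e))) * Z)).
  apply: ler_wpM2r; first exact: ltW.
  apply: le_trans hsec; apply: ler_wpM2r => //; exact: ltW.
apply: le_trans (_ : _ <= (\sum_(A : {set 'I_m} | (2 <= #|A|)%N) \sum_(t : {ffun 'I_m -> 'I_q})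
       \sum_(t' : {ffun 'I_m -> 'I_q} | [forall i in A, t' i == t i]) p ^+ (e + e - #|A|.-1)) * Z) _.
  by apply: ler_wpM2r => //; exact: ltW.
rewrite mulr_suml; apply: le_trans (ler_sum _ cnt) _.
apply: (@le_trans _ _ (\sum_(A : {set 'I_m}) mu ^+ 2)).
  rewrite big_mkcond; apply: ler_sum => A _; case: ifP => // _; exact: ltW.
rewrite sumr_const -[leLHS]mulr_natl; apply: ler_wpM2r; first exact: ltW.
have -> : #|{: {set 'I_m}}| = (2 ^ m)%N.
  by rewrite -cardsT -powersetT card_powerset cardsT card_ord.
by rewrite natrX.
Qed.

(** * Large components and short cycles *)

Definition ord_predecessor k (i : 'I_k.+1) : 'I_k.+1 := inord i.-1.

(** A path through all the indices in order, closed by the edge between its ends; [k.+3] builds in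
    the minimal length 3. *)
Definition cyc n k (y : 'I_k.+3 -> 'I_n) : {set 'I_n * 'I_n} :=
  spair (y ord0) (y ord_max) |: conf y (@ord_predecessor k.+2).

Lemma ord_predecessorE k (i : 'I_k.+1) : ord_predecessor i = i.-1 :> nat.
Proof. by rewrite inordK //; have := ltn_ord i; lia. Qed.

Lemma ord_predecessor_lt k (i : 'I_k.+1) : (0 < i)%N -> (ord_predecessor i < i)%N.
Proof. by rewrite ord_predecessorE; lia. Qed.

Lemma cyc_upper n k (y : 'I_k.+3 -> 'I_n) : injective y -> cyc y \subset upper_pairs n.
Proof.
move=> yinj; rewrite subUset sub1set conf_upper ?andbT //; last exact: ord_predecessor_lt.
by apply: spair_upper; apply/eqP => /yinj /(congr1 val).
Qed.

Lemma card_cyc n k (y : 'I_k.+3 -> 'I_n) : injective y -> #|cyc y| = k.+3.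
Proof.
move=> yinj; rewrite cardsU1 card_conf //; last exact: ord_predecessor_lt.
suff -> : spair (y ord0) (y ord_max) \notin conf y (@ord_predecessor k.+2) by [].
apply/imsetP => -[i]; rewrite inE => i0 /spair_inj [] [/yinj e1 /yinj e2].
  by have := congr1 val e1; rewrite -e2 /= ord_predecessorE.
by rewrite -e1 in i0.
Qed.

(** Recording the parent function costs only the constant factor [v ^ v] in the first moment. *)
Definition has_large_piece v n (E : {set 'I_n * 'I_n}) : bool :=
  [exists t : {ffun 'I_v -> 'I_n} * {ffun 'I_v -> 'I_v},
     (injectiveb t.1 && [forall i : 'I_v, (0 < i)%N ==> (t.2 i < i)%N]) && (conf t.1 t.2 \subset E)].

Definition has_short_cycle v n (E : {set 'I_n * 'I_n}) : bool :=
  [exists k : 'I_v, true && [exists y : {ffun 'I_k.+3 -> 'I_n}, injectiveb y && (cyc y \subset E)]].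

(** A component with at least [v] vertices contains a growth of exactly [v] of them. Hence a cycle,
    lying in one component, has fewer than [v] vertices and is among the short ones. *)
Lemma forest_small_components v n (E : {set 'I_n * 'I_n}) :
  E \subset upper_pairs n -> ~~ has_large_piece v E -> ~~ has_short_cycle v E ->
  acyclic (adjE E) /\ forall z, (#|component (adjE E) z| < v)%N.
Proof.
move=> EU nL nC.
have small z : (#|component (adjE E) z| < v)%N.
  rewrite ltnNge; apply: contra nL => /growth_exists [y [par [yinj hp]]].
  apply/existsP; exists (finfun y, finfun par); rewrite /= -andbA; apply/and3P; split.
  - by apply/injectiveP => i j; rewrite !ffunE; apply: yinj.
  - by apply/forallP => i; rewrite ffunE; apply/implyP => /hp [].
  - apply/subsetP => u /imsetP [i]; rewrite inE => i0 ->; rewrite !ffunE.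
    by apply: spair_adjE => //; case: (hp i i0).
split => // c uc sc; apply/negP => hc.
case: c uc sc hc => // x c uc sc hc.
have hlt : (size (x :: c) < v)%N.
  apply: leq_ltn_trans (small x); rewrite -(card_uniqP uc); apply: subset_leq_card.
  apply/subsetP => z zc; rewrite inE.
  move: hc; rewrite /= => /path_connect; apply.
  by move: zc; rewrite !inE mem_rcons inE => /orP [->|->]; rewrite ?orbT.
have [k hk] : exists k, size (x :: c) = k.+3.
  by case: (size (x :: c)) sc => [|[|[|k]]] // _; exists k.
have kv : (k < v)%N by lia.
move/negP: nC; apply; apply/existsP; exists (Ordinal kv); rewrite andTb.
apply/existsP; exists [ffun i : 'I_k.+3 => nth x (x :: c) i]; apply/andP; split.
  apply/injectiveP => i j; rewrite !ffunE => /eqP; rewrite nth_uniq ?hk //.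
  by move=> /eqP /val_inj.
have hadj i : (i < k.+3)%N -> adjE E (nth x (x :: c) i) (nth x (rcons c x) i).
  move=> ik; have -> : nth x (x :: c) i = nth x (x :: rcons c x) i.
    by rewrite -rcons_cons nth_rcons hk ik.
  by move: hc => /= /(pathP x) h; apply: h; rewrite size_rcons -[X in (_ < X)%N]/(size (x :: c)) hk.
rewrite subUset sub1set; apply/andP; split.
  rewrite !ffunE /= -[x in spair x _]/(nth x (x :: c) 0); apply: spair_adjE => //.
  have := hadj k.+2 (ltnSn _); rewrite nth_rcons; case: (hk) => ->; rewrite ltnn eqxx.
  by rewrite /adjE orbC.
apply/subsetP => u /imsetP [i]; rewrite inE => i0 ->; rewrite !ffunE.
apply: spair_adjE => //; rewrite ord_predecessorE.
have hi := ltn_ord i.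
have := hadj i.-1; rewrite nth_rcons.
have -> : (i.-1 < size c)%N by case: hk => ->; case: (nat_of_ord i) i0 hi.
have -> : nth x (x :: c) i = nth x c i.-1 by case: (nat_of_ord i) i0.
by apply; exact: leq_ltn_trans (leq_pred _) hi.
Qed.

Lemma Pr_not_small_forest (F : realFieldType) v n (p : F) : 0 <= p <= 1 ->
  Pr p (fun E : {set 'I_n * 'I_n} => has_large_piece v E || has_short_cycle v E) <=
  (v ^ v)%:R * (n%:R ^+ v * p ^+ v.-1) + \sum_(k < v) (n%:R * p) ^+ k.+3.
Proof.
move=> hp.
have hL : Pr p (@has_large_piece v n) <= (v ^ v)%:R * (n%:R ^+ v * p ^+ v.-1).
  rewrite /has_large_piece; apply: le_trans (Pr_first_moment (e := v.-1) hp _) _.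
    move=> t /andP[/injectiveP yinj /forallP hpar].
    have h (i : 'I_v) : (0 < i)%N -> (t.2 i < i)%N by apply/implyP.
    by rewrite conf_upper // card_conf.
  by rewrite card_prod !card_ffun !card_ord natrM natrX mulrA [X in _ <= X * _]mulrC.
have hC : Pr p (@has_short_cycle v n) <= \sum_(k < v) (n%:R * p) ^+ k.+3.
  rewrite /has_short_cycle; apply: le_trans (Pr_union _ _ hp) _; apply: ler_sum => k _.
  apply: le_trans (Pr_first_moment (e := k.+3) hp _) _.
    by move=> y /injectiveP yinj; rewrite cyc_upper // card_cyc.
  by rewrite card_ffun !card_ord natrX exprMn.
apply: le_trans (lerD hL hC).
apply: le_trans (_ : Pr p (fun E => [exists c : bool, true && (if c then has_large_piece v E else has_short_cycle v E)]) <= _).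
  apply: Pr_mono => // E _ /orP [h|h]; apply/existsP; [by exists true|by exists false].
apply: le_trans (Pr_union xpredT (fun c E => if c then has_large_piece v E else has_short_cycle v E) hp) _.
by rewrite big_bool.
Qed.

(** * The thresholds *)

Lemma PrGnpE n (p : R) (P : rel 'I_n -> bool) : PrGnp p P = Pr p (fun E => P (adjE E)).
Proof. by rewrite /PrGnp /Pr; apply: eq_bigr => E _; rewrite !RpowE. Qed.

Lemma whp_Pr_predC (P : forall n : nat, rel 'I_n -> bool) (p : nat -> R) :
  (forall n, 0 <= p n <= 1) ->
  (forall eps : R, 0 < eps -> exists N, forall n, (N <= n)%N ->
     Pr (p n) (fun E : {set 'I_n * 'I_n} => ~~ P n (adjE E)) <= eps) ->
  whp P p.
Proof.
move=> hp h eps /RltP; rewrite R0E => eps0.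
have [|N hN] := h (eps / 2); first by rewrite divr_gt0.
exists N => n /ssrnat.leP /hN hn; apply/RltP; rewrite PrGnpE Pr_predC RdistE.
have := Pr_ge0 (fun E : {set 'I_n * 'I_n} => ~~ P n (adjE E)) (hp n).
move: (Pr _ _) hn => x hx x0; rewrite -[R1]/(1 : R) addrC addKr normrN ger0_norm //.
apply: le_lt_trans hx _; lra.
Qed.

Lemma threshold_exponentK v : (1 < v)%N ->
  Rmult (Rdiv (INR v) (INR v.-1)) (INR v.-1) = INR v.
Proof. by move=> v1; rewrite RmultE RdivE divfK // INRE pnatr_eq0; lia. Qed.

(** The power [v.-1] clears the fractional exponent and leaves the order of the expected number of
    copies of a tree on [v] vertices. *)
Lemma threshold_pow (p : R) n v : (0 < n)%N -> (1 < v)%N ->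
  (p * Rpower (INR n) (Rdiv (INR v) (INR v.-1))) ^+ v.-1 = n%:R ^+ v * p ^+ v.-1.
Proof.
move=> n0 v1; rewrite exprMn mulrC; congr (_ * _).
have hn : Rlt 0 (INR n) by apply: lt_0_INR; apply/ssrnat.ltP.
rewrite -[LHS]RpowE -[LHS]Rpower_pow; last exact: exp_pos.
rewrite Rpower_mult threshold_exponentK //.
by rewrite Rpower_pow // RpowE INRE.
Qed.

(** With Y = Q^v p^(v-1), the power [v.-1] of the right-hand side is Q^(v-a) Y^(a-1), which is at
    least Y. So the bound for trees on [v] vertices passes to subtrees and to smaller host trees. *)
Lemma power_bound (F : realFieldType) (Z Q p : F) a v :
  1 <= Z -> 1 <= Q -> 0 <= p -> (2 <= a <= v)%N ->
  Z ^+ v.-1 <= Q ^+ v * p ^+ v.-1 -> Z <= Q ^+ a * p ^+ a.-1.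
Proof.
move=> Z1 Q1 p0 /andP[a2 av] hY.
have Q0 : 0 <= Q by apply: le_trans Q1.
have Z0 : 0 <= Z by apply: le_trans Z1.
rewrite -(@ler_pXn2r _ v.-1) ?nnegrE ?mulr_ge0 ?exprn_ge0 //; last by lia.
set Y := Q ^+ v * p ^+ v.-1 in hY.
have Y1 : 1 <= Y by apply: le_trans hY; rewrite exprn_ege1.
have -> : (Q ^+ a * p ^+ a.-1) ^+ v.-1 = Q ^+ (v - a) * Y ^+ a.-1.
  rewrite /Y !exprMn -!exprM mulrA -exprD; congr (_ ^+ _ * _ ^+ _); last exact: mulnC.
  case: a a2 av => // a _ av; case: v av {hY Y Y1} => // v av /=.
  by rewrite subSS; nia.
apply: le_trans hY _; apply: le_trans (_ : Y <= Y ^+ a.-1) _.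
  by apply: ler_eXnr => //; lia.
by rewrite ler_peMl ?exprn_ge0 ?(le_trans _ Y1) // exprn_ege1.
Qed.

Lemma residue_classes_bound (n L : nat) : (0 < L)%N -> (L <= n)%N ->
  (0 < n %/ L)%N /\ (n <= 2 * L * (n %/ L))%N.
Proof.
move=> L0 Ln; have q0 : (0 < n %/ L)%N by rewrite divn_gt0.
split => //; have := ltn_ceil n L0; nia.
Qed.

Lemma maker_threshold (b : nat) (VH : finType) (eH : rel VH) v (p : nat -> R)
   (T : VH -> {m : nat & rel 'I_m}) mf :
  (0 < b)%N -> symmetric eH -> (1 < v)%N ->
  (forall x, [/\ (tag (T x) <= v)%N, simple_graph (tagged (T x)), is_tree (tagged (T x)) &
     maker_wins eH (component eH x) b (tagged (T x)) true]) ->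
  (forall n, 0 <= p n <= 1) ->
  cv_infty (fun n => Rmult (p n) (Rpower (INR n) (Rdiv (INR v) (INR v.-1)))) ->
  whp (fun n (eG : rel 'I_n) => maker_wins eH [set: VH] b eG mf) p.
Proof.
move=> hb sH v1 hT hp hinf; apply: whp_Pr_predC => // eps eps0.
pose N := (b + b * (v.+1 * #|VH|)).+1.
pose I : finType := (VH * 'I_N)%type.
(* Every slot receives [v] residue classes; the successor keeps [L] positive when there is no
   slot. *)
pose L := (#|I|.+1 * v)%N.
have L0 : (0 < L)%N by rewrite muln_gt0 /= (ltnW v1).
pose c0 (u : I) := (enum_rank u * v)%N.
pose A n (x : VH) (j : 'I_N) :=
  [set z : 'I_n | (c0 (x, j) <= z %% L < c0 (x, j) + tag (T x))%N].
(* A slot fails with probability at most [2 ^+ v / Z], so this [Z] brings the union bound over all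
   slots below [eps]. *)
pose Z : R := 1 + #|I|%:R * 2 ^+ v / eps.
have Z1 : 1 <= Z by rewrite lerDl divr_ge0 ?mulr_ge0 ?exprn_ge0 ?ler0n // ltW.
have Z0 : 0 < Z by apply: lt_le_trans Z1.
(* The factor [(2 * L) ^ v] pays in advance for replacing [n] by [q = n %/ L], where
   [n <= 2 * L * q]. *)
have [N1 hN1] := hinf ((2 * L)%:R ^+ v * Z).
exists (N1 + L)%N => n hn.
have Ln : (L <= n)%N by lia.
have [q0 hq] := residue_classes_bound L0 Ln.
set q := (n %/ L)%N in q0 hq.
have hqL : (q * L <= n)%N by apply: leq_divM.
have n0 : (0 < n)%N by lia.
have /andP[p0 p1] := hp n.
have hY : Z ^+ v.-1 <= q%:R ^+ v * p n ^+ v.-1.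
  have /hN1 /RltP h : (n >= N1)%coq_nat by apply/ssrnat.leP; lia.
  set w := Rmult _ _ in h.
  have hw : w ^+ v.-1 = n%:R ^+ v * p n ^+ v.-1 := threshold_pow (p n) n0 v1.
  have C1 : 1 <= (2 * L)%:R ^+ v :> R by rewrite exprn_ege1 // ler1n muln_gt0.
  have C0 : 0 < (2 * L)%:R ^+ v :> R by apply: lt_le_trans C1.
  have : ((2 * L)%:R ^+ v * Z) ^+ v.-1 <= w ^+ v.-1.
    have CZ0 : 0 <= (2 * L)%:R ^+ v * Z by apply: mulr_ge0; apply: ltW.
    by apply: lerXn2r; rewrite ?nnegrE // ?(le_trans CZ0) // ltW.
  rewrite hw exprMn => h1.
  rewrite -(ler_pM2l C0); apply: le_trans (_ : ((2 * L)%:R ^+ v) ^+ v.-1 * Z ^+ v.-1 <= _).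
    apply: ler_wpM2r; first by apply: exprn_ge0; exact: ltW.
    by apply: ler_eXnr => //; lia.
  apply: le_trans h1 _; rewrite mulrA ler_wpM2r ?exprn_ge0 // -exprMn -natrM.
  by rewrite lerXn2r ?nnegrE ?ler0n // ler_nat.
apply: le_trans (_ : Pr (p n) (fun E => [exists u : I, true &&
    ~~ has_copy (tagged (T u.1)) setT (adjE E) (A n u.1 u.2)]) <= _).
  apply: Pr_mono => // E _; apply: contraR; rewrite negb_exists => /forallP hc.
  apply: (@maker_wins_many_copies _ _ _ v N _ _ (fun x => tag (T x)) (fun x => tagged (T x)) (A n)) => //.
  - by move=> x; case: (hT x).
  - by move=> x; case: (hT x).
  - by move=> x j; have := hc (x, j); rewrite negbK.
  - move=> x j x' j' z; rewrite !inE => /andP[h1 h2] /andP[h3 h4].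
    have [m1 _ _ _] := hT x; have [m2 _ _ _] := hT x'.
    suff /enum_rank_inj [-> ->] : enum_rank (x, j) = enum_rank (x', j') by [].
    apply: val_inj; move: h1 h2 h3 h4; rewrite /c0 /=.
    move: (nat_of_ord (enum_rank (x, j))) (nat_of_ord (enum_rank (x', j'))) => r r' h1 h2 h3 h4.
    have dv s k : (k <= v)%N -> (s * v <= z %% L)%N -> (z %% L < s * v + k)%N ->
        ((z %% L) %/ v = s)%N.
      move=> kv hs1 hs2; rewrite -(subnKC hs1) divnMDl; last exact: ltnW.
      by rewrite divn_small ?addn0 // ltn_subLR //; apply: leq_trans hs2 _; rewrite leq_add2l.
    by rewrite -(dv _ _ m1 h1 h2) -(dv _ _ m2 h3 h4).
apply: le_trans (Pr_union _ _ (hp n)) _.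
apply: le_trans (_ : _ <= \sum_(u : I) 2 ^+ v / Z) _.
  apply: ler_sum => -[x j] _; rewrite ler_pdivlMr //=.
  have [mv sT tT _] := hT x.
  apply: (@le_trans _ _ (2 ^+ tag (T x))); last by rewrite ler_weXn2l // ler1n.
  apply: (@Pr_no_tree_copy _ _ _ _ _ _ q) => //.
    rewrite /c0 /L mulSn addnC; apply: leq_add => //; rewrite leq_mul2r; apply/orP; right.
    exact: ltnW.
  move=> a /andP[a2 am]; apply: (power_bound (v := v)) => //; first by rewrite ler1n.
  by rewrite a2 (leq_trans am).
rewrite sumr_const -[leLHS]mulr_natl mulrA ler_pdivrMr // /Z mulrDr mulr1 mulrCA divff ?mulr1 ?gt_eqF //.
by rewrite lerDr ltW.
Qed.

Lemma breaker_threshold (b : nat) (VH : finType) (eH : rel VH) x v (p : nat -> R) mf :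
  (0 < b)%N -> (1 < v)%N ->
  (forall (m : nat) (eT' : rel 'I_m), simple_graph eT' -> is_tree eT' ->
     maker_wins eH (component eH x) b eT' true -> (v <= m)%N) ->
  (forall n, 0 <= p n <= 1) ->
  Un_cv (fun n => Rmult (p n) (Rpower (INR n) (Rdiv (INR v) (INR v.-1)))) R0 ->
  whp (fun n (eG : rel 'I_n) => breaker_wins eH [set: VH] b eG mf) p.
Proof.
move=> hb v1 hmin hp h0; apply: whp_Pr_predC => // eps eps0.
(* [v ^ v] comes from the trees and [v] from the cycle lengths: with w = p n^(v/(v-1)) below 1,
   every term of the first moment bound is at most its coefficient times w. *)
pose C : R := (v ^ v)%:R + v%:R.
have C0 : 0 < C by rewrite ltr_wpDl ?ler0n // ltr0n ltnW.
pose d : R := Num.min 1 (eps / C).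
have d0 : 0 < d by rewrite lt_min ltr01 divr_gt0.
have [|N hN] := h0 d; first exact/RltP.
exists N.+1 => n hn.
have n0 : (0 < n)%N by lia.
have /andP[p0 p1] := hp n.
have /hN : (n >= N)%coq_nat by apply/ssrnat.leP; lia.
move/RltP; rewrite RdistE -[R0]/(0 : R) subr0.
(* Since v/(v-1) is at least 1, the hypothesis also makes n p small, which excludes short cycles. *)
have hle : n%:R * p n <= Rmult (p n) (Rpower (INR n) (Rdiv (INR v) (INR v.-1))).
  rewrite RmultE mulrC ler_wpM2l // -INRE -[X in X <= _]Rpower_1; last first.
    by apply: lt_0_INR; apply/ssrnat.ltP.
  apply/RleP; apply: Rle_Rpower; first by apply: (le_INR 1); apply/ssrnat.leP.
  have v0 : Rlt 0 (INR v.-1) by apply: lt_0_INR; lia.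
  apply: (Rmult_le_reg_r (INR v.-1)) => //.
  by rewrite threshold_exponentK // Rmult_1_l; apply: le_INR; lia.
set w := Rmult _ _ in hle *.
have hw : w ^+ v.-1 = n%:R ^+ v * p n ^+ v.-1 := threshold_pow (p n) n0 v1.
have w0 : 0 <= w by apply: le_trans hle; rewrite mulr_ge0 ?ler0n.
rewrite ger0_norm // lt_min => /andP[w1 weps].
apply: le_trans (_ : Pr (p n) (fun E : {set 'I_n * 'I_n} =>
    has_large_piece v E || has_short_cycle v E) <= _).
  apply: Pr_mono => // E EU; apply: contraR; rewrite negb_or => /andP[h1 h2].
  have [h3 h4] := forest_small_components EU h1 h2.
  by apply: (breaker_wins_small_components (x := x) (v := v)) => //; apply: adjE_simple.
apply: le_trans (Pr_not_small_forest v n (hp n)) _.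
rewrite -hw; apply: le_trans (_ : C * w <= _); last first.
  by rewrite mulrC -ler_pdivlMr // ltW.
have wle j : w ^+ j.+1 <= w by rewrite exprS ler_piMr // exprn_ile1 // ltW.
rewrite /C mulrDl lerD //.
  apply: ler_wpM2l; first exact: ler0n.
  have v2 : (0 < v.-1)%N by lia.
  by rewrite -(prednK v2); apply: wle.
apply: le_trans (_ : \sum_(k < v) w <= _); last by rewrite sumr_const card_ord mulr_natl.
apply: ler_sum => k _; apply: le_trans (wle k.+2).
by rewrite lerXn2r // nnegrE // mulr_ge0.
Qed.

Theorem theorem2 (b : nat) (hb : (0 < b)%N)
  (VH : finType) (eH : rel VH) (hH : simple_graph eH) (hforest : is_forest eH) :
  (* (1) *)
  (is_tree eH ->
     exists (m : nat) (eT : rel 'I_m),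
       simple_graph eT /\ is_tree eT /\ maker_wins eH [set: VH] b eT true)
  /\
  (* (2) *)
  ((exists x y : VH, eH x y) ->
   forall (v : nat) (eT : rel 'I_v),
     simple_graph eT -> is_tree eT ->
     (* T_max is a minimum-size Maker-win tree T^(i)_min for some component T_i *)
     (exists x : VH,
        maker_wins eH (component eH x) b eT true /\
        (forall (m : nat) (eT' : rel 'I_m),
           simple_graph eT' -> is_tree eT' ->
           maker_wins eH (component eH x) b eT' true -> (v <= m)%N)) ->
     (* ... with the maximum number of vertices among all T^(i)_min *)
     (forall x : VH, exists (m : nat) (eT' : rel 'I_m),
        (m <= v)%N /\ simple_graph eT' /\ is_tree eT' /\
        maker_wins eH (component eH x) b eT' true) ->
     forall p : nat -> R, (forall n, Rle R0 (p n) /\ Rle (p n) R1) ->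
       let thr := Rdiv (INR v) (INR (nedges eT)) in
       (cv_infty (fun n => Rmult (p n) (Rpower (INR n) thr)) ->
          forall makerfirst : bool,
            whp (fun n (eG : rel 'I_n) => maker_wins eH [set: VH] b eG makerfirst) p)
       /\
       (Un_cv (fun n => Rmult (p n) (Rpower (INR n) thr)) R0 ->
          forall makerfirst : bool,
            whp (fun n (eG : rel 'I_n) => breaker_wins eH [set: VH] b eG makerfirst) p)).
Proof.
split; first exact: maker_wins_on_tree.
move=> [x0 [y0 exy]] v eT sT tT [x [_ hmin]] hall p hp thr.
have [sH iH] := hH.
(* The component of the edge [x0 y0] has a host tree on at most [v] vertices, and this tree contains
   a copy of the edge. *)
have v1 : (1 < v)%N.
  have [m [eT' [mv [_ [_ /maker_wins_forces/forces_setT]]]]] := hall x0.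
  case/(_ _)/has_copyP => [M M'|f [_ finj _]]; first exact: has_copyS.
  apply: leq_trans mv; rewrite -(card_ord m).
  have xy : x0 != y0 by apply: contraTneq exy => ->; rewrite iH.
  have cx : x0 \in component eH x0 by rewrite inE connect0.
  have cy : y0 \in component eH x0 by rewrite inE connect1.
  have fxy : f x0 != f y0 by apply: contra xy => /eqP /finj -> //.
  have -> : 2%N = #|[set f x0; f y0]| by rewrite cards2 fxy.
  exact: max_card.
have hp' n : (0 <= p n <= 1)%R.
  by have [/RleP h1 /RleP h2] := hp n; apply/andP.
rewrite /thr nedges_tree //; split => hlim mf; last first.
  exact: (breaker_threshold mf hb v1 hmin hp' hlim).
have hT y : exists T : {m : nat & rel 'I_m}, [/\ (tag T <= v)%N, simple_graph (tagged T),
    is_tree (tagged T) & maker_wins eH (component eH y) b (tagged T) true].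
  by have [m [eT' [h1 [h2 [h3 h4]]]]] := hall y; exists (Tagged (fun m => rel 'I_m) eT').
apply: (maker_threshold (T := fun y => sval (cid (hT y))) mf hb sH v1 _ hp' hlim) => y.
exact: (svalP (cid (hT y))).
Qed.
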